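(* There exists a universal constant $c>0$ such that for any $n\in\mathbb{N}$ and for any two increasing (Borel measurable) subsets $A$ and $B$ of $\mathbb{R}^n$, $$\mu^{\otimes n}(A\cap B)-\mu^{\otimes n}(A)\,\mu^{\otimes n}(B)\ \ge\ c\sum_{i=1}^n \frac{I_i^{\mathcal G}(A)\,I_i^{\mathcal G}(B)}{\sqrt{\log(e/I_i^{\mathcal G}(A))\,\log(e/I_i^{\mathcal G}(B))}}.$$
   Context: $\mu$ is the standard Gaussian measure on $\mathbb{R}$, $\mu(dx) = (1/\sqrt{2\pi})e^{-x^2/2}dx$, and $\mu^{\otimes n}$ is the product measure on $\mathbb{R}^n$. All sets are Borel measurable. A set $A\subseteq\mathbb{R}^n$ is increasing if its characteristic function $\mathbf{1}_A$ is an increasing (non-decreasing) function of each coordinate. For a Borel set $S \subseteq \mathbb{R}$, its lower Minkowski content is $\mu^{+}(S) := \liminf_{r\downarrow 0} \frac{\mu(S+[-r,r])-\mu(S)}{r}$. For a Borel set $A\subseteq\mathbb{R}^n$, $1\le i\le n$ and $x\in\mathbb{R}^n$, the fiber is $A_i^x := \{y\in\mathbb{R} : (x_1,\dots,x_{i-1},y,x_{i+1},\dots,x_n)\in A\}$. The geometric influence of the $i$-th coordinate on $A$ is $I_i^{\mathcal G}(A) := \mathbb{E}_x[\mu^{+}(A_i^x)]$, where $x$ is distributed according to $\mu^{\otimes n}$. Convention: a summand in which one of the two influences is $0$ is interpreted as $0$. *)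

(* Defs.v *)
From HB Require Import structures.
From mathcomp Require Import all_boot all_order all_algebra.
From mathcomp Require Import all_classical all_reals all_analysis.

Set Implicit Arguments.
Unset Strict Implicit.
Unset Printing Implicit Defensive.

Import Order.TTheory GRing.Theory Num.Theory.
Import numFieldNormedType.Exports.

Local Open Scope classical_set_scope.
Local Open Scope ring_scope.

Section power_probability.
Context d (T : measurableType d) (R : realType).

Definition cons_pair n (p : T * n.-tuple T) : n.+1.-tuple T :=
  [the n.+1.-tuple T of p.1 :: p.2].

Lemma measurable_cons_pair n :
  measurable_fun [set: T * n.-tuple T] (@cons_pair n).
Proof. exact: measurable_cons measurable_fst measurable_snd. Qed.

HB.instance Definition _ n := isMeasurableFun.Build _ _ _ _
  (@cons_pair n) (@measurable_cons_pair n).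

(* The n-fold product of P, on the sigma-algebra of n.-tuple T generated by
   the coordinates; power_prob_box below characterizes it. *)
Fixpoint power_prob (P : probability T R) n : probability (n.-tuple T) R :=
  match n with
  | 0 => \d_([tuple] : 0.-tuple T)
  | m.+1 => distribution (P \x power_prob P m)%E (@cons_pair m)
  end.

Lemma measurable_box n (F : 'I_n -> set T) :
  (forall i, measurable (F i)) ->
  measurable [set x : n.-tuple T | forall i, F i (tnth x i)].
Proof.
move=> mF.
rewrite (_ : mkset _ = \big[setI/setT]_(i < n) ((@tnth _ T ^~ i) @^-1` F i)).
  apply: bigsetI_measurable => i _; rewrite -[X in measurable X]setTI.
  exact: measurable_tnth.
apply/seteqP; split=> x /=.
  by move=> Fx; rewrite -bigcap_seq /= => i _; exact: Fx.
by move=> + i; rewrite (bigD1 i)//= => -[].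
Qed.

Lemma power_prob_box (P : probability T R) n (F : 'I_n -> set T) :
  (forall i, measurable (F i)) ->
  power_prob P n [set x | forall i, F i (tnth x i)] = (\prod_(i < n) P (F i))%E.
Proof.
elim: n F => [|n IH] F mF.
  rewrite big_ord0 /= diracE mem_set//.
  by case.
rewrite big_ord_recl /= -IH; last by move=> i; exact: mF.
have mbox : measurable [set x : n.-tuple T | forall i, F (lift ord0 i) (tnth x i)].
  exact: measurable_box (fun i => mF (lift ord0 i)).
rewrite -(product_measure1E _ _ (mF ord0) mbox).
rewrite /distribution /pushforward; congr (_ _).
apply/seteqP; split=> -[x t] /=.
  move=> H; split=> [|i]; first exact: (H ord0).
  by have := H (lift ord0 i); rewrite tnthS.
by move=> [Fx Ft] i; case: (unliftP ord0 i) => [j|] ->//; rewrite tnthS.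
Qed.

End power_probability.

Section geometric_influence.
Variable R : realType.

Definition gauss : probability (measurableTypeR R) R := normal_prob 0 1.

Definition gauss_power n : probability (n.-tuple (measurableTypeR R)) R :=
  power_prob gauss n.

Definition update n (i : 'I_n) (x : n.-tuple (measurableTypeR R)) (y : R) :
    n.-tuple (measurableTypeR R) :=
  [tuple if j == i then y else tnth x j | j < n].

Definition increasing n (A : set (n.-tuple (measurableTypeR R))) :=
  forall (i : 'I_n) x,
    {homo (fun y : R => \1_A (update i x y) : R) : s t / s <= t}.

Definition fiber n (A : set (n.-tuple (measurableTypeR R))) (i : 'I_n) x :
    set R :=
  [set y | A (update i x y)].

Definition enlargement (S : set R) (r : R) : set R :=
  [set s + t | s in S & t in `[- r, r]].

Definition lower_minkowski (S : set R) : \bar R :=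
  limf_einf
    (fun r : R => (gauss (enlargement S r) - gauss S) / r%:E)%E (0 : R)^'+.

(* The integral lives in \bar R, but it is a finite number at most (2pi)^(-1/2)
   when A is increasing, since the fibers are then half-lines. *)
Definition influence n (A : set (n.-tuple (measurableTypeR R))) (i : 'I_n) :
    \bar R :=
  (\int[gauss_power n]_x lower_minkowski (fiber A i x))%E.

End geometric_influence.

(* Main.v *)
Require Import Defs.
From HB Require Import structures.
From mathcomp Require Import all_boot all_order all_algebra.
From mathcomp Require Import all_classical all_reals all_analysis.
From mathcomp Require Import measurable_realfun ring lra.

Import Order.TTheory GRing.Theory Num.Theory.
Import numFieldNormedType.Exports.

Set Implicit Arguments.
Unset Strict Implicit.
Unset Printing Implicit Defensive.

Local Open Scope classical_set_scope.
Local Open Scope ring_scope.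

(** The theorem follows from raising the correlation of a pair of Gaussian
vectors one coordinate at a time.

Two Gaussian vectors X and Y are coupled through the density
prod_j (1 + r_j theta_j(x_j) theta'_j(y_j)) with respect to the product of
their laws, where theta_j and theta'_j are the identity truncated at levels
K_j and L_j.  For r = 0 the probability that X is in A and Y is in B is
mu(A) mu(B); for every admissible r it is at most mu(A cap B), because upward
closed subsets of the line are nested and theta has mean zero
([mean_coupling_density_le_diagonal]).

Switching on the coordinate i adds exactly r_i times the coupled mean of
H_A(X) H_B(Y), where H_A(x) is the mean of theta_i on the fiber of A at x
([coupled_mean_switch]).  A fiber is empty, or the whole line, where the
mean of theta_i and the Minkowski content vanish, or a half-line starting at
some point u.  The mean of theta_i on the half-line is
max(0, phi(u) - phi(K_i)) and the Minkowski content is phi(u).  Hence H_A has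
mean at least I_i(A) - phi(K_i), which is at least I_i(A)/2 once
K_i^2 = 2 log(e/I_i(A)).

It remains to bound a coupled mean of H_A(X) H_B(Y) below by a constant times
the product of the means.  This is reverse hypercontractivity
([reverse_hypercontractive]): the coupled mean is at least the product of the
L^p and L^q norms with p = 1 - s and q = 1 - t smaller than 1, provided that
every r_j is at most a constant times sqrt(s t) and every r_j K_j L_j is small.
Taking s = 1/K_i^2 and t = 1/L_i^2 loses only a constant factor, because H_A
and H_B have values in [0,1], and it asks that r_j be at most a constant times
1/(K_i L_i) for all the coordinates that are already on.  So r_i is taken to be a constant times
1/(K_i L_i) and the coordinates are switched on by increasing r_i; the gain at
step i is then a constant times I_i(A) I_i(B)/(K_i L_i), the summand of the
theorem.

Reverse hypercontractivity tensorizes by Fubini, so only the line has to be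
treated.  There, for F of mean 1, Young's inequality against a tilted Gaussian
bounds the moment of F against theta by the deficit d = 1 - E F^p: either
s (E F theta)^2 or |E F theta|/K is at most a constant times d
([moment_dichotomy]).  This makes the correction r (E F theta)(E G theta') at
most the loss 1 - (1-d)(1-d') in the product of the norms. *)

(** * Means of bounded measurable functions *)

Section bounded_measurable.
Context {R : realType}.

(** All the integrands below are bounded: they are built from indicators,
truncations, powers and exponentials of bounded functions.  This makes them
integrable for every probability, so linearity and Fubini need no further
integrability argument. *)
Definition bmfun d (T : measurableType d) (f : T -> R) :=
  measurable_fun [set: T] f /\ exists M, forall x, `|f x| <= M.

Section closure.
Context d (T : measurableType d).
Implicit Types f g : T -> R.

Lemma bmfun_cst (c : R) : bmfun (fun _ : T => c).
Proof. by split; [exact: measurable_cst|exists `|c|]. Qed.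

Lemma bmfunD f g : bmfun f -> bmfun g -> bmfun (fun x => f x + g x).
Proof.
move=> [mf [M fM]] [mg [N gN]]; split; first exact: measurable_funD.
by exists (M + N) => x; rewrite (le_trans (ler_normD _ _))// lerD.
Qed.

Lemma bmfunM f g : bmfun f -> bmfun g -> bmfun (fun x => f x * g x).
Proof.
move=> [mf [M fM]] [mg [N gN]]; split; first exact: measurable_funM.
by exists (M * N) => x; rewrite normrM ler_pM.
Qed.

Lemma bmfun_prod (I : eqType) (s : seq I) (h : I -> T -> R) :
  (forall i, bmfun (h i)) -> bmfun (fun x => \prod_(i <- s) h i x).
Proof.
move=> bh; elim: s => [|i s ih].
  by under eq_fun do rewrite big_nil; exact: bmfun_cst.
by under eq_fun do rewrite big_cons; exact: bmfunM.
Qed.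

Lemma bmfun_indic (A : set T) : measurable A -> bmfun (\1_A : T -> R).
Proof.
move=> mA; split; first exact: measurable_indic.
by exists 1 => x; rewrite indicE; case: (_ \in _); rewrite ?normr1 ?normr0.
Qed.

Lemma bmfun_powR f p : 0 <= p -> (forall x, 0 <= f x) -> bmfun f ->
  bmfun (fun x => f x `^ p).
Proof.
move=> p0 f0 [mf [M fM]]; split.
  exact: (measurableT_comp (measurable_powR _) mf).
exists (M `^ p) => x; rewrite ger0_norm ?powR_ge0//.
have := fM x; rewrite ger0_norm// => fxM.
by rewrite ge0_ler_powR// nnegrE// (le_trans _ fxM).
Qed.

End closure.

Lemma bmfun_comp d1 d2 (T1 : measurableType d1) (T2 : measurableType d2)
    (f : T2 -> R) (g : T1 -> T2) :
  bmfun f -> measurable_fun setT g -> bmfun (fun x => f (g x)).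
Proof.
move=> [mf [M fM]] mg; split; first exact: (measurableT_comp mf mg).
by exists M => x.
Qed.

Section expectation.
Context d (T : measurableType d) (P : probability T R).
Implicit Types f g : T -> R.

Lemma bmfun_integrable f : bmfun f -> P.-integrable setT (EFin \o f).
Proof.
move=> [mf [M fM]]; apply: measurable_bounded_integrable => //.
  exact: (le_lt_trans (probability_le1 P measurableT) (ltry _)).
by exists M; split; rewrite ?num_real// => N MN x _; exact: le_trans (fM x)
  (ltW MN).
Qed.

Lemma mean_cst c : \int[P]_x c = c.
Proof. by rewrite Rintegral_cst//= probability_setT mulr1. Qed.

Lemma meanD f g : bmfun f -> bmfun g ->
  \int[P]_x (f x + g x) = \int[P]_x f x + \int[P]_x g x.
Proof. by move=> bf bg; rewrite RintegralD//; exact: bmfun_integrable. Qed.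

Lemma meanZl c f : bmfun f -> \int[P]_x (c * f x) = c * \int[P]_x f x.
Proof. by move=> bf; rewrite RintegralZl//; exact: bmfun_integrable. Qed.

Lemma meanZr c f : bmfun f -> \int[P]_x (f x * c) = \int[P]_x f x * c.
Proof. by move=> bf; rewrite RintegralZr//; exact: bmfun_integrable. Qed.

Lemma le_mean f g : bmfun f -> bmfun g -> (forall x, f x <= g x) ->
  \int[P]_x f x <= \int[P]_x g x.
Proof. by move=> bf bg fg; apply: le_Rintegral => //;
  exact: bmfun_integrable. Qed.

Lemma mean_ge0 f : (forall x, 0 <= f x) -> 0 <= \int[P]_x f x.
Proof. by move=> f0; apply: Rintegral_ge0. Qed.

Lemma mean_le c f : bmfun f -> (forall x, f x <= c) -> \int[P]_x f x <= c.
Proof. by move=> bf fc; rewrite -[leRHS]mean_cst; apply: le_mean => //;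
  exact: bmfun_cst. Qed.

Lemma mean_indic (A : set T) : measurable A -> \int[P]_x \1_A x = fine (P A).
Proof. by move=> mA; rewrite /Rintegral integral_indic// setIT. Qed.

Lemma EFin_mean f : bmfun f -> (\int[P]_x f x)%:E = (\int[P]_x (f x)%:E)%E.
Proof.
move=> /bmfun_integrable intf; rewrite /Rintegral fineK//.
exact: integrable_fin_num.
Qed.

End expectation.

Section fubini.
Context d1 d2 (T1 : measurableType d1) (T2 : measurableType d2).
Context (P1 : probability T1 R) (P2 : probability T2 R).
Variable f : T1 -> T2 -> R.
Hypothesis bf : bmfun (fun z => f z.1 z.2).

Lemma bmfun_section1 x : bmfun (f x).
Proof. exact: (bmfun_comp bf (pair1_measurable x)). Qed.

Lemma bmfun_section2 y : bmfun (f ^~ y).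
Proof. exact: (bmfun_comp bf (pair2_measurable y)). Qed.

Lemma bmfun_mean : bmfun (fun x => \int[P2]_y f x y).
Proof.
split.
  apply/measurable_EFinP.
  rewrite (_ : _ \o _ = fubini_F P2 (fun z => (f z.1 z.2)%:E)).
    exact: measurable_fubini_F (bmfun_integrable (P1 \x P2)%E bf).
  by apply/funext => x /=; rewrite EFin_mean//; exact: bmfun_section1.
have [_ [M fM]] := bf.
exists M => x; rewrite (le_trans (le_normr_Rintegral _ _))//.
  exact/bmfun_integrable/bmfun_section1.
apply: mean_le => [|y]; last exact: (fM (x, y)).
have [mf [N fN]] := bmfun_section1 x.
split; first exact: measurableT_comp.
by exists N => y; rewrite normr_id.
Qed.

Lemma mean_prod : \int[(P1 \x P2)%E]_z f z.1 z.2 = \int[P1]_x \int[P2]_y f x y.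
Proof.
have iP := bmfun_integrable (P1 \x P2)%E bf.
rewrite /Rintegral -integral12_prod_meas1//; congr fine.
apply: eq_integral => x _; rewrite /fubini_F /=.
by rewrite -EFin_mean//; exact: bmfun_section1.
Qed.

Lemma mean_swap :
  \int[P1]_x \int[P2]_y f x y = \int[P2]_y \int[P1]_x f x y.
Proof.
have iP := bmfun_integrable (P1 \x P2)%E bf.
transitivity (fine (\int[P1]_x \int[P2]_y (f x y)%:E)%E).
  congr fine; apply: eq_integral => x _; rewrite EFin_mean//.
  exact: bmfun_section1.
rewrite (Fubini iP); congr fine; apply: eq_integral => y _.
by rewrite EFin_mean//; exact: bmfun_section2.
Qed.

End fubini.

End bounded_measurable.

(** * The Gaussian density *)

Section gaussian_line.
Context {R : realType}.
Implicit Types (x K : R) (U : set R).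
Local Notation gauss := (gauss R).
Local Notation mu := (@lebesgue_measure R).
Local Notation phi := (@normal_pdf R 0 1).

Let one_neq0 : (1 : R) != 0. Proof. exact: oner_neq0. Qed.

Lemma gauss_pdfE x : phi x = normal_peak 1 * expR (- x ^+ 2 / 2).
Proof. by rewrite normal_pdfE// /normal_fun subr0 expr1n. Qed.

Lemma gauss_pdfN x : phi (- x) = phi x.
Proof. by rewrite !gauss_pdfE sqrrN. Qed.

Lemma gauss_pdf_ge0 x : 0 <= phi x. Proof. exact: normal_pdf_ge0. Qed.

Lemma le_gauss_pdf x y : `|x| <= `|y| -> phi y <= phi x.
Proof.
move=> xy; rewrite !gauss_pdfE ler_wpM2l ?normal_peak_ge0// ler_expR.
by rewrite ler_pM2r ?invr_gt0// lerN2 -(real_normK (num_real x)) -(real_normK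
  (num_real y)) lerXn2r// nnegrE.
Qed.

Lemma normal_peak1_le : normal_peak 1 <= 2^-1 :> R.
Proof.
have p2 : 2 <= pi :> R by exact: pi_ge2.
rewrite /normal_peak expr1n mul1r lef_pV2 ?posrE ?sqrtr_gt0//; last first.
  by rewrite mulrn_wgt0// pi_gt0.
rewrite -[leLHS]ger0_norm// -sqrtr_sqr ler_sqrt; last first.
  by rewrite mulrn_wge0// pi_ge0.
by rewrite -mulr_natr; nra.
Qed.

Lemma gauss_pdf_le x : phi x <= 2^-1.
Proof. exact: le_trans (normal_pdf_ub _ _ one_neq0) normal_peak1_le. Qed.

(** Change of variables along the Radon-Nikodym derivative of [gauss], which is
[phi] almost everywhere because both have the same integral over every
measurable set. *)
Lemma integral_gauss (f : R -> R) U : measurable U ->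
  gauss.-integrable U (EFin \o f) ->
  (\int[gauss]_(x in U) (f x)%:E = \int[mu]_(x in U) (f x * phi x)%:E)%E.
Proof.
move=> mU intf.
have dom := @normal_prob_dominates R 0 1.
have mf := measurable_int _ intf.
rewrite -(Radon_Nikodym_change_of_variables dom)//=.
under [in RHS]eq_integral do rewrite EFinM.
apply: ae_eq_integral => //.
- apply: emeasurable_funM => //; apply: (measurable_int mu).
  apply: (integrableS _ _ (@subsetT _ _)) => //=.
  exact: Radon_Nikodym_integrable.
- apply: emeasurable_funM => //=; apply/measurableT_comp => //=.
  by apply/measurable_funTS; exact: measurable_normal_pdf.
- apply: ae_eqe_mul2l => /=.
  rewrite Radon_NikodymE//=.
  case: cid => /= h [h1 h2 h3].
  apply: integral_ae_eq => //=.
  + exact: integrableS h2.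
  + by apply/measurable_funTS/measurableT_comp =>//;
    exact: measurable_normal_pdf.
  + by move=> E EU mE; rewrite -h3.
Qed.

End gaussian_line.

Section gaussian_symmetry.
Context {R : realType}.
Local Notation gauss := (gauss R).
Local Notation mu := (@lebesgue_measure R).
Local Notation phi := (@normal_pdf R 0 1).
Implicit Types f : measurableTypeR R -> R.

Lemma integrable_gauss_density f : bmfun f ->
  mu.-integrable setT (fun x : measurableTypeR R => (f x * phi x)%:E).
Proof.
move=> [mf [M fM]].
have intp := integrableZl measurableT M (@integrable_normal_pdf R 0 1).
apply: le_integrable intp => //=.
  by apply/measurable_EFinP/measurable_funM => //; exact: measurable_normal_pdf.
move=> x _; rewrite lee_fin !normrM ler_wpM2r// (le_trans (fM x))//.
exact: ler_norm.
Qed.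

Lemma mean_gauss f : bmfun f ->
  (\int[gauss]_x f x)%:E = (\int[mu]_x (f x * phi x)%:E)%E.
Proof.
by move=> bf; rewrite EFin_mean// integral_gauss//; exact: bmfun_integrable.
Qed.

Lemma mean_gaussN f : bmfun f -> \int[gauss]_x f (- x) = \int[gauss]_x f x.
Proof.
move=> bf.
have mN : measurable_fun setT (-%R : measurableTypeR R -> measurableTypeR R).
  exact: oppr_measurable.
have bfN := bmfun_comp bf mN.
apply: EFin_inj; rewrite !mean_gauss//.
rewrite -[RHS](@eq_measure_integral _ _ _ _ mu (pushforward mu (-%R :
  measurableTypeR R -> measurableTypeR R))); last first.
  by move=> A mA _; exact: lebesgue_measureN.
have int1 := integrable_gauss_density bfN.
have int2 := integrable_gauss_density bf.
rewrite [RHS]integral_pushforward//.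
- by apply: eq_integral => x _ /=; rewrite gauss_pdfN.
- exact: (measurable_int mu).
- rewrite preimage_setT; apply: eq_integrable int1 => //.
  by move=> x _ /=; rewrite gauss_pdfN.
Qed.

End gaussian_symmetry.

(** * The truncated identity on half-lines *)

Section truncated_identity.
Context {R : realType}.
Local Notation gauss := (gauss R).
Local Notation mu := (@lebesgue_measure R).
Local Notation phi := (@normal_pdf R 0 1).
Implicit Types (a x K : R) (U : set R).

(** The sharp cut, rather than the clamping of [x] to the interval from [- K] to
[K], is what makes the mean over a half-line exactly
[Num.max 0 (phi a - phi K)]. *)
Definition trunc K x : R := if `|x| <= K then x else 0.

Lemma truncE K x : trunc K x = x * \1_`[- K, K] x.
Proof.
rewrite /trunc indicE mem_setE in_itv/= -ler_norml.
by case: ifP; rewrite ?mulr1 ?mulr0.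
Qed.

Lemma truncN K x : trunc K (- x) = - trunc K x.
Proof. by rewrite /trunc normrN; case: ifP; rewrite ?oppr0. Qed.

Lemma trunc_le K x : 0 <= K -> `|trunc K x| <= K.
Proof. by rewrite /trunc; case: ifP; rewrite ?normr0. Qed.

Lemma bmfun_trunc K : 0 <= K -> bmfun (trunc K : measurableTypeR R -> R).
Proof.
move=> K0; split; last by exists K => x; exact: trunc_le.
rewrite (_ : trunc K = (fun x => x * \1_`[- K, K] x)); last first.
  by apply/funext => x; exact: truncE.
by apply: measurable_funM => //; exact: measurable_indic.
Qed.

Definition upset U := forall s t, U s -> s <= t -> U t.

Lemma upsetP U : upset U ->
  [\/ U = set0, U = setT | exists b a, U = [set` Interval (BSide b a) +oo%O]].
Proof.
move=> upU; have [->|/set0P[u Uu]] := eqVneq U set0; first by constructor 1.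
have [->|/setTPn[v nUv]] := eqVneq U setT; first by constructor 2.
have lbv t : U t -> v < t.
  by move=> Ut; rewrite ltNge; apply/negP => tv; apply: nUv; exact: upU Ut tv.
have iU : has_inf U by split; [exists u|exists v => t /lbv/ltW].
constructor 3.
have gtU t : inf U < t -> U t.
  move=> /(inf_lt iU.1)[w Uw wt]; exact: upU Uw (ltW wt).
have geU t : U t -> inf U <= t by move=> Ut; apply: ge_inf => //; exact: iU.2.
have [UU|nU] := pselect (U (inf U)).
  exists true, (inf U); apply/seteqP; split => t /=; rewrite in_itv/= andbT.
    exact: geU.
  by rewrite le_eqVlt => /predU1P[<-//|/gtU].
exists false, (inf U); apply/seteqP; split => t /=; rewrite in_itv/= andbT.
  move=> Ut; rewrite lt_neqAle geU// andbT; apply: contra_not_neq nU => ->;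
    exact: Ut.
exact: gtU.
Qed.

Lemma is_derive_gauss_pdf x : is_derive x 1 (- phi) (x * phi x).
Proof.
rewrite (_ : - phi = - normal_peak 1 \*: (expR \o (- 2^-1 \*: (id ^+ 2 : R ->
  R)))); last first.
  apply/funext => y /=; rewrite -[LHS]/(- phi y) gauss_pdfE [RHS]mulNr.
  by congr (- (_ * expR _)); rewrite -[RHS]/(- 2^-1 * y ^+ 2); lra.
apply: is_derive_eq.
rewrite /= gauss_pdfE -[X in expR X]/(- 2^-1 * x ^+ 2) /GRing.scale /=.
rewrite (_ : - x ^+ 2 / 2 = - 2^-1 * x ^+ 2); last by lra.
by rewrite expr1; field.
Qed.

Lemma integral_id_gauss b a K : a <= K ->
  (\int[mu]_(x in [set` Interval (BSide b a) (BRight K)]) (x * phi x)%:E =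
   (phi a - phi K)%:E)%E.
Proof.
have mxp (A : set R) : measurable_fun A (fun x => (x * phi x)%:E).
  apply/measurable_funTS/measurable_EFinP/measurable_funM => //.
  exact: measurable_normal_pdf.
have cphi : continuous phi by exact: continuous_normal_pdf.
rewrite le_eqVlt => /predU1P[->|aK].
  by rewrite integral_itv_bndoo// set_itvoo0 integral_set0 subrr.
rewrite (integral_itv_bndoo b false)// -(integral_itv_bndoo true false)//.
rewrite (@continuous_FTC2 _ _ (- phi))//.
- by rewrite -EFinB; congr EFin;
  rewrite -[X in X - _]/(- phi K) -[X in _ - X]/(- phi a); lra.
- apply: continuous_subspaceT => x; apply: cvgM; first exact: cvg_id.
  exact: cphi.
- split => [x _||]; last 2 first.
  + by apply: cvg_at_right_filter; apply: cvgN; exact: cphi.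
  + by apply: cvg_at_left_filter; apply: cvgN; exact: cphi.
  exact: (@ex_derive _ _ _ _ _ _ _ (is_derive_gauss_pdf x)).
- move=> x _; rewrite derive1E.
  exact: (@derive_val _ _ _ _ _ _ _ (is_derive_gauss_pdf x)).
Qed.

Definition tail_mean K U := \int[gauss]_x (\1_U x * trunc K x).

(** Since [x * phi x] is the derivative of [- phi], the mean over the part of the
half-line that lies between [- K] and [K] is a difference of two values of
[phi]; it vanishes when the half-line contains that whole interval, [phi] being
even. *)
Lemma tail_mean_half_line K b a : 0 <= K ->
  tail_mean K [set` Interval (BSide b a) +oo%O] = Num.max 0 (phi a - phi K).
Proof.
move=> K0; apply: EFin_inj; set U := [set` _].
have mU : measurable U by exact: measurable_itv.
rewrite mean_gauss; last by apply: bmfunM; [exact: bmfun_indic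
  |exact: bmfun_trunc].
transitivity (\int[mu]_(x in U `&` [set` `[(- K)%R, K]]) (x * phi x)%:E)%E.
  rewrite [RHS]integral_mkcond; apply: eq_integral => x _.
  rewrite patchE in_setI truncE !indicE.
  by do 2 case: (_ \in _); rewrite /= ?mul1r ?mulr1 ?mulr0 ?mul0r.
have [aK|Ka] := leP a K; last first.
  rewrite (_ : _ `&` _ = set0) ?integral_set0; last first.
    apply/seteqP; split => x //= [];
      rewrite /U/= !in_itv/= andbT => ax /andP[_ xK].
    by move: ax; case: b {U mU} => /= ax; have := le_lt_trans xK Ka; lra.
  rewrite max_l// subr_le0 le_gauss_pdf// !ger0_norm//;
    last exact: ltW (le_lt_trans K0 Ka).
  exact: ltW.
have [Ka|aK'] := leP (- K) a.
  rewrite (_ : _ `&` _ = [set` Interval (BSide b a) (BRight K)]); last first.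
    apply/seteqP; split => x /=; rewrite /U/= !in_itv/= ?andbT.
      by move=> [-> /andP[_ ->]].
    move=> /andP[ax xK]; rewrite xK ax andbT; split=> //.
    by rewrite (le_trans Ka)//; case: b {U mU} ax => //= /ltW.
  rewrite integral_id_gauss// max_r// subr_ge0 le_gauss_pdf// (ger0_norm K0).
  by rewrite ler_norml Ka aK.
rewrite (_ : _ `&` _ = `[- K, K]%classic); last first.
  apply/seteqP; split => x /=; rewrite /U/= !in_itv/= ?andbT; first by case.
  move=> /andP[Kx xK]; rewrite Kx xK; split=> //.
  by have := lt_le_trans aK' Kx; case: b {U mU} => //= /ltW.
rewrite integral_id_gauss ?gauss_pdfN ?subrr; last by lra.
rewrite max_l// subr_le0 le_gauss_pdf// (ger0_norm K0) ler0_norm; last by lra.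
by lra.
Qed.

Lemma tail_mean_set0 K : tail_mean K set0 = 0.
Proof.
rewrite /tail_mean (_ : (fun _ => _) = cst 0) ?mean_cst//.
by apply/funext => x; rewrite indic0 mul0r.
Qed.

Lemma tail_mean_setT K : 0 <= K -> tail_mean K setT = 0.
Proof.
move=> K0; have bt := bmfun_trunc K0.
suff : \int[gauss]_x trunc K x = 0.
  rewrite /tail_mean => <-; congr (Rintegral _ _ _).
  by apply/funext => x; rewrite indicT mul1r.
have /= := mean_gaussN bt.
under eq_Rintegral do rewrite truncN -mulN1r.
rewrite meanZl// => h; lra.
Qed.

Lemma tail_mean_ge0 K U : 0 <= K -> upset U -> 0 <= tail_mean K U.
Proof.
move=> K0 /upsetP[->|->|[b [a ->]]].
- by rewrite tail_mean_set0.
- by rewrite tail_mean_setT.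
- by rewrite tail_mean_half_line// le_max lexx.
Qed.

Lemma tail_mean_le1 K U : 0 <= K -> upset U -> tail_mean K U <= 1.
Proof.
move=> K0 /upsetP[->|->|[b [a ->]]].
- by rewrite tail_mean_set0.
- by rewrite tail_mean_setT.
- rewrite tail_mean_half_line// ge_max ler01/=.
  by have := gauss_pdf_le a; have := gauss_pdf_ge0 K; lra.
Qed.

End truncated_identity.

(** * Minkowski content of half-lines *)

Section boundary_content.
Context {R : realType}.
Local Notation gauss := (gauss R).
Local Notation mu := (@lebesgue_measure R).
Local Notation phi := (@normal_pdf R 0 1).
Implicit Types (a K l : R) (U : set R).

Lemma limf_einf_at_right_le (f : R -> \bar R) l :
  (forall e, 0 < e -> \forall r \near 0^'+, (f r <= (l + e)%:E)%E) ->
  (limf_einf f (0 : R)^'+ <= l%:E)%E.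
Proof.
move=> fl; rewrite limf_einfE; apply: ge_ereal_sup => _ [V FV <-].
apply/lee_addgt0Pr => e e0; rewrite -EFinD.
have [r [Vr fr]] : (V `&` [set r | (f r <= (l + e)%:E)%E]) !=set0.
  by apply: (@filter_ex _ (0 : R)^'+); apply: filterI => //; exact: (fl e e0).
by apply: le_trans fr; apply: ereal_inf_lbound; exists r.
Qed.

Lemma upset_measurable U : upset U -> measurable U.
Proof. by move=> /upsetP[->|->|[b [a ->]]]//; exact: measurable_itv. Qed.

Lemma gauss_itv_le a r M : 0 < r ->
  (forall x, a - r <= x <= a -> phi x <= M) ->
  (gauss [set` `[(a - r)%R, a]] <= (M * r)%:E)%E.
Proof.
move=> r0 phiM; rewrite /gauss/= /normal_prob.
apply: (@le_trans _ _ (\int[mu]_(x in [set` `[(a - r)%R, a]]) (cst M%:E x)))%E.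
  apply: ge0_le_integral => //.
  - by move=> x _; rewrite lee_fin gauss_pdf_ge0.
  - by apply/measurable_funTS/measurable_EFinP; exact: measurable_normal_pdf.
rewrite integral_cst//= lebesgue_measure_itv/= lte_fin ltrBlDr ltrDl r0.
by rewrite -EFinB -EFinM lee_fin; lra.
Qed.

Lemma enlargement_half_line b a r : 0 < r ->
  enlargement [set` Interval (BSide b a) +oo%O] r `<=`
  [set` `[a - r, a]] `|` [set` Interval (BSide b a) +oo%O].
Proof.
move=> r0 z [s /=]; rewrite in_itv/= andbT => As [t];
  rewrite in_itv/= => /andP[rt tr] <-.
have as_ : a <= s by case: b As => //= /ltW.
have [st|st] := leP (s + t) a; [left|right]; rewrite /= in_itv/=.
  by rewrite st andbT; lra.
by rewrite andbT; case: (b) => //=; exact: ltW.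
Qed.

Lemma upset_enlargement U r : upset U -> upset (enlargement U r).
Proof.
move=> upU x y [s Us [t tr <-]] xy; exists (y - t); last by exists t;
  rewrite ?subrK.
by apply: upU Us _; rewrite lerBrDr.
Qed.

(** Enlarging a half-line by [r] adds an interval of length [r] next to its
endpoint [a], and on this interval [phi] exceeds [phi a] by at most [e] once [r]
is small. *)
Lemma lower_minkowski_half_line b a :
  (lower_minkowski [set` Interval (BSide b a) +oo%O] <= (phi a)%:E)%E.
Proof.
set U := [set` _]; have mU : measurable U by exact: measurable_itv.
have upU : upset U.
  move=> s t; rewrite /U/= !in_itv/= !andbT; case: (b) => /=;
    first exact: le_trans.
  exact: lt_le_trans.
apply: limf_einf_at_right_le => e e0.
have /cvgrPdist_le/(_ e e0) : phi x @[x --> a] --> phi a.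
  by apply: continuous_normal_pdf; exact: oner_neq0.
move=> /nbhs_ballP[d /= d0 phid].
near=> r.
have r0 : 0 < r by [].
have rd : r < d by near: r; exact: nbhs_right_lt.
have mE : measurable (enlargement U r) by apply: upset_measurable;
  exact: upset_enlargement.
rewrite inver gt_eqF// lee_pdivrMr// -EFinM.
rewrite leeBlDr//; last exact: fin_num_measure.
apply: (@le_trans _ _ (gauss ([set` `[(a - r)%R, a]] `|` U))).
  apply: le_measure; rewrite ?inE//; first exact: measurableU.
  exact: enlargement_half_line.
apply: le_trans (measureU2 _ _ _) _ => //.
rewrite leeD2r//; apply: gauss_itv_le => // x /andP[rx xa].
have : ball a d x by rewrite /ball/= ger0_norm; lra.
by move=> /phid; rewrite ler_norml; lra.
Unshelve. all: by end_near. Qed.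

Lemma lower_minkowski_trivial U : U = set0 \/ U = setT ->
  (lower_minkowski U <= 0)%E.
Proof.
move=> UT; apply: limf_einf_at_right_le => e e0; near=> r.
have r0 : 0 < r by [].
rewrite (_ : enlargement U r = U); last first.
  case: UT => ->; apply/seteqP; split => x //=; first by case.
  by move=> _; exists x => //; exists 0;
    rewrite ?addr0//= in_itv/= oppr_le0 ltW.
rewrite subee ?mul0e; last first.
  by apply: fin_num_measure; case: UT => ->.
by rewrite lee_fin; lra.
Unshelve. all: by end_near. Qed.

(** This exchanges the Minkowski content of a fiber for an integral over the
fiber; [phi K] bounds what the truncation forgets. *)
Lemma lower_minkowski_le K U : 0 <= K -> upset U ->
  (lower_minkowski U <= (tail_mean K U + phi K)%:E)%E.
Proof.
move=> K0 /upsetP[UE|UE|[b [a ->]]].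
- rewrite (le_trans (lower_minkowski_trivial _)); [by []|by left|].
  by rewrite UE tail_mean_set0 add0r lee_fin gauss_pdf_ge0.
- rewrite (le_trans (lower_minkowski_trivial _)); [by []|by right|].
  by rewrite UE tail_mean_setT// add0r lee_fin gauss_pdf_ge0.
- rewrite (le_trans (lower_minkowski_half_line _ _))// lee_fin
  tail_mean_half_line//.
  by rewrite -lerBlDr le_max lexx orbT.
Qed.

End boundary_content.

(** * Exponential moments of the truncated identity *)

Section subgaussian.
Context {R : realType}.
Local Notation gauss := (gauss R).
Local Notation mu := (@lebesgue_measure R).
Local Notation phi := (@normal_pdf R 0 1).
Implicit Types (x K k eta v : R).

Lemma normal_peakE v : 0 < v -> normal_peak (Num.sqrt v) = normal_peak 1 /
  Num.sqrt v.
Proof.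
move=> v0; rewrite /normal_peak sqr_sqrtr ?ltW// expr1n mul1r -mulrnAr.
by rewrite sqrtrM ?ltW// invfM mulrC.
Qed.

(** Completing the square: tilting the standard Gaussian by a quadratic exponent
gives, up to a factor, the Gaussian of mean [k * v] and variance [v]. *)
Lemma gauss_tilt k eta v x : 0 < v -> v * (1 - 2 * eta) = 1 ->
  expR (k * x + eta * x ^+ 2) * phi x =
  Num.sqrt v * expR (k ^+ 2 * v / 2) * normal_pdf (k * v) (Num.sqrt v) x.
Proof.
move=> v0 veta; have s0 : Num.sqrt v != 0 by rewrite sqrtr_eq0 -ltNge.
rewrite gauss_pdfE normal_pdfE// normal_peakE// /normal_fun sqr_sqrtr ?ltW//.
rewrite [RHS](_ : _ = normal_peak 1 * (expR (k ^+ 2 * v / 2) *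
   expR (- (x - k * v) ^+ 2 / (v *+ 2)))); last by field.
rewrite mulrCA; congr (_ * _); rewrite -!expRD; congr expR.
have -> : eta = (1 - v^-1) / 2.
  have v1 : v^-1 = 1 - 2 * eta by apply: (mulfI (lt0r_neq0 v0));
    rewrite veta divff// gt_eqF.
  by rewrite v1; lra.
by rewrite -mulr_natr; field; rewrite gt_eqF.
Qed.

(** By symmetry the exponential of the odd term may be replaced by a hyperbolic
cosine.  Then undoing the truncation can only increase the integrand, which is 1
where the truncation acts and at least 1 without it, and the resulting Gaussian
integral is explicit. *)
Lemma mean_expR_trunc K k eta : 0 <= K -> 0 <= eta <= 4^-1 ->
  \int[gauss]_x expR (k * trunc K x + eta * trunc K x ^+ 2) <=
  expR (2 * eta + k ^+ 2).
Proof.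
move=> K0 /andP[eta0 eta4].
pose f x := expR (k * trunc K x + eta * trunc K x ^+ 2).
have bt := bmfun_trunc K0.
have bf : bmfun (f : measurableTypeR R -> R).
  split.
    apply: measurableT_comp => //; apply: measurable_funD.
      by apply: measurable_funM => //; exact: bt.1.
    by apply: measurable_funM => //; apply: measurable_funX; exact: bt.1.
  exists (expR (`|k| * K + eta * K ^+ 2)) => x.
  rewrite ger0_norm ?expR_ge0// ler_expR lerD//.
    rewrite (le_trans (ler_norm _))// normrM ler_wpM2l//; exact: trunc_le.
  rewrite ler_wpM2l// -(real_normK (num_real _)) lerXn2r ?nnegrE//;
    exact: trunc_le.
have bfN := bmfun_comp bf (@oppr_measurable R setT).
(* Averaging the values at x and - x symmetrizes the integrand. *)
have -> : \int[gauss]_x expR (k * trunc K x + eta * trunc K x ^+ 2) =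
    \int[gauss]_x (2^-1 * (f x + f (- x))).
  rewrite meanZl; last exact: bmfunD.
  by rewrite meanD// mean_gaussN// -/f; lra.
have bg : bmfun (fun x : measurableTypeR R => 2^-1 * (f x + f (- x))).
  by apply: bmfunM; [exact: bmfun_cst|exact: bmfunD].
pose v := (1 - 2 * eta)^-1.
have veta : v * (1 - 2 * eta) = 1 by rewrite mulVf// gt_eqF//; lra.
have v0 : 0 < v by rewrite invr_gt0; lra.
pose A := Num.sqrt v * expR (k ^+ 2 * v / 2).
have A0 : 0 <= A by rewrite mulr_ge0// ?sqrtr_ge0// expR_ge0.
apply: (@le_trans _ _ A); last first.
  rewrite /A expRD ler_pM// ?sqrtr_ge0 ?expR_ge0//; last first.
    have v2 : v <= 2 by nra.
    by rewrite ler_expR; have := sqr_ge0 k; nra.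
  rewrite -[leRHS]ger0_norm ?expR_ge0// -sqrtr_sqr ler_sqrt ?sqr_ge0//.
  rewrite -expRM_natl.
  have := expR_ge1Dx (2 * (2 * eta)) => e1.
  apply: le_trans e1.
  have e2 : 1 <= (1 + 2 * (2 * eta)) * (1 - 2 * eta) by nra.
  have : v * 1 <= v * ((1 + 2 * (2 * eta)) * (1 - 2 * eta)) by rewrite ler_pM2l.
  by rewrite mulrCA veta; lra.
rewrite -lee_fin mean_gauss//.
pose h m x : R := A / 2 * normal_pdf m (Num.sqrt v) x.
have h0 m x : 0 <= h m x by rewrite mulr_ge0 ?normal_pdf_ge0//; lra.
have mh m : measurable_fun setT (EFin \o h m).
  by apply/measurable_EFinP/measurable_funM => //; exact: measurable_normal_pdf.
have inth m : (\int[mu]_x (h m x)%:E = (A / 2)%:E)%E.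
  under eq_integral do rewrite EFinM.
  rewrite ge0_integralZl//.
  - by rewrite integral_normal_pdf mule1.
  - by apply/measurable_EFinP; exact: measurable_normal_pdf.
  - by move=> x _; rewrite lee_fin normal_pdf_ge0.
  - by rewrite lee_fin; lra.
have pw (x : R) : 2^-1 * (f x + f (- x)) * phi x <= h (k * v) x + h (- k * v) x.
  have t1 := gauss_tilt k x v0 veta.
  have t2 := gauss_tilt (- k) x v0 veta.
  rewrite sqrrN in t2.
  rewrite /h [A / 2 * _]mulrAC [A / 2 * _]mulrAC -t1 -t2.
  rewrite /f truncN /trunc; case: ifP => _.
    by rewrite sqrrN mulrN -mulNr le_eqVlt; apply/orP; left; apply/eqP; field.
  rewrite oppr0 !mulr0 expr0n/= mulr0 addr0 expR0.
  have e1 := expR_ge1Dx (k * x + eta * x ^+ 2).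
  have e2 := expR_ge1Dx (- k * x + eta * x ^+ 2).
  have e3 : 0 <= eta * x ^+ 2 by rewrite mulr_ge0// sqr_ge0.
  have p0 := gauss_pdf_ge0 x.
  rewrite -mulrDl -mulrDl [leRHS]mulrAC ler_wpM2r//.
  lra.
apply: (@le_trans _ _ (\int[mu]_x ((h (k * v) x)%:E + (h (- k * v) x)%:E))%E).
  apply: ge0_le_integral => //.
  - move=> x _; rewrite lee_fin mulr_ge0 ?gauss_pdf_ge0//.
    by rewrite mulr_ge0// addr_ge0// expR_ge0.
  - apply/measurable_EFinP/measurable_funM; first exact: bg.1.
    exact: measurable_normal_pdf.
  - by apply: emeasurable_funD; exact: mh.
  by move=> x _; rewrite -EFinD lee_fin pw.
rewrite ge0_integralD//; try exact: mh; try by move=> x _; rewrite lee_fin.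
by rewrite !inth -EFinD lee_fin; lra.
Qed.

End subgaussian.

(** * Reverse hypercontractivity on the line *)

Section truncated_moments.
Context {R : realType}.
Local Notation gauss := (gauss R).
Implicit Types (s l K : R) (F G : measurableTypeR R -> R).

(** Young's inequality for [(u * expR w) `^ p] times the [s]-th power of
[expR (- (p / s * w))]: the tilt [w] is free. *)
Lemma le_young (p s u w : R) : 0 < p -> 0 < s -> p + s = 1 -> 0 <= u ->
  u `^ p <= p * (u * expR w) + s * expR (- (p / s * w)).
Proof.
move=> p0 s0 ps u0.
have a0 : 0 <= u * expR w by rewrite mulr_ge0// expR_ge0.
have ps' : p^-1^-1 + s^-1^-1 = 1 by rewrite !invrK.
have ip0 : 0 < p^-1 by rewrite invr_gt0.
have is0 : 0 < s^-1 by rewrite invr_gt0.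
have := @conjugate_powR R ((u * expR w) `^ p) (expR (- (p * w))) p^-1 s^-1
  (powR_ge0 _ _) (expR_ge0 _) ip0 is0 ps'.
rewrite -powRrM mulfV ?gt_eqF// powRr1// -expRM !invrK powRM ?expR_ge0//.
rewrite -expRM -mulrA -expRD [w * p]mulrC subrr expR0 mulr1.
by rewrite [_ * p]mulrC [_ * s]mulrC (_ : - (p * w) / s = - (p / s * w))//; lra.
Qed.

Lemma expR_le1Dx2 (z : R) : - 2^-1 <= z -> expR (z - 2 * z ^+ 2) <= 1 + z.
Proof.
move=> z2; have e := expR_ge1Dx (- (z - 2 * z ^+ 2)).
rewrite expRN in e; have e0 := expR_gt0 (z - 2 * z ^+ 2).
set y := expR _ in e e0 *.
have y1 : y * (1 + - (z - 2 * z ^+ 2)) <= 1 by rewrite -ler_pdivlMl// mulr1.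
have h : 1 <= (1 + z) * (1 + - (z - 2 * z ^+ 2)).
  have -> : (1 + z) * (1 + - (z - 2 * z ^+ 2)) = 1 + z ^+ 2 * (1 + 2 * z) by
    ring.
  by rewrite lerDl mulr_ge0 ?sqr_ge0//; lra.
have c0 : 0 < 1 + - (z - 2 * z ^+ 2) by nra.
by rewrite -(ler_pM2r c0) (le_trans y1).
Qed.

Lemma expR_le1D3x (c : R) : 0 <= c <= 2 / 3 -> expR c <= 1 + 3 * c.
Proof.
move=> /andP[c0 c1]; have e := expR_ge1Dx (- c).
rewrite expRN in e; have e0 := expR_gt0 c; set y := expR c in e e0 *.
have y1 : y * (1 + - c) <= 1 by rewrite -ler_pdivlMl// mulr1.
have c2 : 0 < 1 + - c by lra.
rewrite -(ler_pM2r c2) (le_trans y1)//; nra.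
Qed.

Section moments.
Variables (s : R) (F : measurableTypeR R -> R).
Hypotheses (s0 : 0 < s) (s2 : s <= 2^-1).
Hypotheses (bF : bmfun F) (F0 : forall x, 0 <= F x).
Local Notation p := (1 - s).
Let p0 : 0 < p. Proof. by have h := s2; lra. Qed.
Let ps : p + s = 1. Proof. by lra. Qed.
Hypothesis F1 : \int[gauss]_x F x = 1.

Let bFp : bmfun (fun x => F x `^ p).
Proof. by apply: bmfun_powR => //; exact: ltW. Qed.

Local Notation d := (1 - \int[gauss]_x (F x `^ p)).

(** For [F] of mean 1, the deficit [1 - \int[gauss]_x (F x `^ p)] measures how far
[F] is from being constant. *)
Lemma deficit_ge0 : 0 <= d.
Proof.
have bpF : bmfun (fun x => p * F x) by apply: bmfunM => //; exact: bmfun_cst.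
have bs : bmfun (fun _ : measurableTypeR R => s) by exact: bmfun_cst.
have E1 : \int[gauss]_x (p * F x + s) = 1.
  by rewrite meanD// meanZl// F1 mean_cst; lra.
rewrite subr_ge0 -[leRHS]E1; apply: le_mean; [exact: bFp|exact: bmfunD|].
move=> x; have := @le_young p s (F x) 0 p0 s0 ps (F0 x).
by rewrite mulr0 oppr0 expR0 !mulr1.
Qed.

Lemma deficit_le1 : d <= 1.
Proof. by rewrite lerBlDr lerDl mean_ge0// => x; exact: powR_ge0. Qed.

(** Young's inequality with the tilt [l * t - 2 * (l * t) ^+ 2 + c], where [t] is
the truncated identity.  The factor [expR (l * t - 2 * (l * t) ^+ 2)] is at most
[1 + l * t], so that the first term becomes affine in the moment of [F]; the
second term is an exponential moment of [t], and the constant [c] is chosen to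
compensate it. *)
Lemma moment_le_deficit K l : 0 <= K -> `|l| * K <= 2^-1 -> 8 * l ^+ 2 <= s ->
  - l * \int[gauss]_x (F x * trunc K x) <= 15 * (d + l ^+ 2 / s).
Proof.
move=> K0 lK ls.
have bt := bmfun_trunc K0; have hs2 := s2; have hs0 := s0.
have hps : p + s = 1 := ps; have hp0 : 0 < p := p0.
set X := \int[gauss]_x (F x * trunc K x).
pose m := p / s.
have m1 : 1 <= m by rewrite /m ler_pdivlMr// mul1r; lra.
have ms : m * s = p by rewrite /m divfK// gt_eqF.
have ml2 : m * l ^+ 2 <= 8^-1.
  have : m * l ^+ 2 * s <= 8^-1 * s.
    by rewrite mulrAC ms; have := sqr_ge0 l; nra.
  by rewrite ler_pM2r.
have ml0 : 0 <= m * l ^+ 2 by rewrite mulr_ge0 ?sqr_ge0//; lra.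
(* With this c the exponential moment below is at most expR (m * c): it is
   bounded by 4 * m * l ^+ 2 + (m * l) ^+ 2 in the exponent, and 1 <= m. *)
pose c := 5 * (m * l ^+ 2).
have ec : expR c <= 1 + 3 * c by apply: expR_le1D3x; rewrite /c; lra.
have ec1 : 1 <= expR c by have := expR_ge1Dx c; rewrite /c; lra.
pose V x := expR (- m * l * trunc K x + 2 * m * l ^+ 2 * trunc K x ^+ 2).
have bV : bmfun (V : measurableTypeR R -> R).
  split.
    apply: measurableT_comp => //; apply: measurable_funD.
      by apply: measurable_funM => //; exact: bt.1.
    by apply: measurable_funM => //; apply: measurable_funX; exact: bt.1.
  exists (expR (`|- m * l| * K + 2 * m * l ^+ 2 * K ^+ 2)) => x.
  rewrite ger0_norm ?expR_ge0// ler_expR lerD//.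
    rewrite (le_trans (ler_norm _))// normrM ler_wpM2l//; exact: trunc_le.
  rewrite ler_wpM2l//; first by lra.
  rewrite -(real_normK (num_real _)) lerXn2r ?nnegrE//; exact: trunc_le.
have EV : \int[gauss]_x V x <= expR (m * c).
  apply: le_trans (mean_expR_trunc _ K0 _) _; first by lra.
  rewrite ler_expR /c.
  have : 0 <= (m - 1) * (m * l ^+ 2) by rewrite mulr_ge0//; lra.
  by rewrite (_ : (- m * l) ^+ 2 = m * (m * l ^+ 2)); [lra|ring].
have bFt : bmfun (fun x => F x * (1 + l * trunc K x)).
  apply: bmfunM => //; apply: bmfunD; first exact: bmfun_cst.
  by apply: bmfunM => //; exact: bmfun_cst.
have EFt : \int[gauss]_x (F x * (1 + l * trunc K x)) = 1 + l * X.
  rewrite -[in RHS]F1 /X -meanZl; last exact: bmfunM.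
  rewrite -meanD//; last by apply: bmfunM; [exact: bmfun_cst|exact: bmfunM].
  by apply: eq_Rintegral => x _; ring.
have key : 1 - d <= p * expR c * (1 + l * X) + s.
  rewrite opprB addrC subrK -EFt -meanZl//.
  apply: (@le_trans _ _ (\int[gauss]_x (p * expR c * (F x * (1 + l * trunc K x))
      + s * expR (- (m * c)) * V x))).
    apply: le_mean => //.
      by apply: bmfunD; apply: bmfunM => //; exact: bmfun_cst.
    move=> x; set t := trunc K x.
    have := @le_young p s (F x) (l * t - 2 * (l * t) ^+ 2 + c) p0 s0 ps (F0 x).
    move=> /le_trans; apply; rewrite lerD//.
      rewrite -[leRHS]mulrA ler_pM2l// [expR c * _]mulrCA ler_wpM2l// [_ +
        c]addrC expRD ler_wpM2l ?expR_ge0//.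
      apply: expR_le1Dx2; rewrite lerNl.
      apply: le_trans (ler_norm _) _; rewrite normrN normrM.
      by apply: le_trans lK; rewrite ler_wpM2l// trunc_le.
    rewrite -[leRHS]mulrA ler_pM2l// -expRD ler_expR -/m le_eqVlt; apply/orP;
      left.
    by apply/eqP; rewrite -/t; ring.
  rewrite meanD; [|by apply: bmfunM => //; exact: bmfun_cst..].
  rewrite lerD2l meanZl// -mulrA ler_piMr//; first exact: ltW.
  by rewrite expRN [_^-1 * _]mulrC ler_pdivrMr ?expR_gt0// mul1r.
have d0 := deficit_ge0.
have [lX0|lX0] := leP 0 (l * X).
  have : 0 <= l ^+ 2 / s by rewrite divr_ge0 ?sqr_ge0// ltW.
  by rewrite mulNr; lra.
have plX : - (p * expR c * (l * X)) <= d + p * (expR c - 1) by lra.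
have p2 : 2^-1 <= p by lra.
have : p * (- (l * X)) <= p * expR c * (- (l * X)).
  by rewrite -mulrA ler_pM2l// ler_peMl//; lra.
have cl : c <= 5 * (l ^+ 2 / s).
  rewrite /c /m ler_pM2l// -mulrA [s^-1 * _]mulrC ler_piMl//; last by lra.
  by rewrite divr_ge0 ?sqr_ge0// ltW.
have : p * (expR c - 1) <= p * (15 * (l ^+ 2 / s)) by rewrite ler_pM2l//; lra.
have : 2^-1 * d <= p * d by rewrite ler_wpM2r.
move=> h1 h2 h3.
rewrite mulNr -(ler_pM2l p0); lra.
Qed.

End moments.

End truncated_moments.

Section reverse_hypercontractivity.
Context {R : realType}.
Local Notation gauss := (gauss R).
Implicit Types (s l K : R) (F G : measurableTypeR R -> R).

(** Any large enough constant would do.  It is sealed so that conversion never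
unfolds the numeral. *)
Fact hc_const_subproof : {M : R | M = 7200}.
Proof. by exists 7200. Qed.

Definition hc_const : R := sval hc_const_subproof.

Lemma hc_constE : hc_const = 7200.
Proof. exact: (svalP hc_const_subproof). Qed.

Lemma hc_const_ge1 : 1 <= hc_const.
Proof. by rewrite hc_constE; lra. Qed.

(** [moment_le_deficit] is optimized over [l], which is constrained by
[`|l| * K <= 2^-1] and [8 * l ^+ 2 <= s].  The unconstrained optimum [m1] gives
the first alternative.  When a constraint is active it decides the outcome: the
one on [l * K] gives the second alternative, and the one on [l ^+ 2] gives the
first alternative again, because [d <= 1]. *)
Lemma moment_dichotomy s F K : 0 < s -> s <= 2^-1 -> bmfun F ->
  (forall x, 0 <= F x) -> \int[gauss]_x F x = 1 -> 0 <= K ->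
  let X := \int[gauss]_x (F x * trunc K x) in
  let d := 1 - \int[gauss]_x (F x `^ (1 - s)) in
  s * X ^+ 2 <= hc_const * d \/ `|X| <= hc_const * K * d.
Proof.
move=> s0 s2 bF F0 F1 K0 X d.
suff : s * X ^+ 2 <= hc_const * d \/ `|X| <= 60 * K * d.
  move=> [|H]; [by left|right; apply: le_trans H _].
  by rewrite -!mulrA ler_wpM2r ?mulr_ge0 ?deficit_ge0// hc_constE; clear; lra.
have d0 : 0 <= d := deficit_ge0 s0 s2 bF F0 F1.
have d1 : d <= 1 by exact: deficit_le1.
have H m : 0 <= m -> m * K <= 2^-1 -> 8 * m ^+ 2 <= s ->
    m * `|X| <= 15 * (d + m ^+ 2 / s).
  move=> m0 mK ms.
  have [X0|X0] := leP 0 X.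
    have := @moment_le_deficit _ s F s0 s2 bF F0 F1 K (- m) K0.
    by rewrite normrN (ger0_norm m0) (ger0_norm X0) sqrrN opprK; apply.
  have := @moment_le_deficit _ s F s0 s2 bF F0 F1 K m K0.
  by rewrite (ger0_norm m0) (ltr0_norm X0) mulrN -mulNr; apply.
(* Below the optimum the quadratic term is absorbed by half of the left side. *)
have {}H m : 0 <= m -> m * K <= 2^-1 -> 8 * m ^+ 2 <= s ->
    30 * m <= s * `|X| -> m * `|X| <= 30 * d.
  move=> m0 mK ms mX.
  have := H m m0 mK ms.
  have : 15 * (m ^+ 2 / s) <= m * `|X| / 2.
    rewrite mulrA ler_pdivrMr//.
    have := ler_wpM2l m0 mX; lra.
  lra.
pose m1 := s * `|X| / 30.
have m10 : 0 <= m1 by rewrite divr_ge0// mulr_ge0// ltW.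
have Hm1 m : m <= m1 -> 30 * m <= s * `|X| by rewrite /m1; lra.
have K2 m : 0 <= m -> m <= m1 -> 8 * m ^+ 2 <= s -> 2^-1 < m * K ->
  `|X| <= 60 * K * d.
  move=> m0 mm1 ms mK.
  have K0' : 0 < K.
    rewrite lt_neqAle K0 andbT; apply/eqP => K00; move: mK; rewrite -K00 mulr0;
      lra.
  pose m2 := (2 * K)^-1.
  have m20 : 0 <= m2 by rewrite invr_ge0 mulr_ge0.
  have m2K : m2 * K = 2^-1 by rewrite /m2; field; rewrite gt_eqF.
  have m2m : m2 <= m by rewrite -(ler_pM2r K0') m2K ltW.
  have := H m2 m20 _ _ (Hm1 m2 (le_trans m2m mm1)).
  rewrite m2K lexx => /(_ isT) h.
  have : m2 * `|X| <= 30 * d.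
    by apply: h; apply: le_trans ms; rewrite ler_pM2l// lerXn2r// nnegrE.
  have -> : 30 * d = m2 * (60 * K * d) by rewrite /m2; field; rewrite gt_eqF.
  by rewrite ler_pM2l// invr_gt0 mulr_gt0.
have X2 : X ^+ 2 = `|X| ^+ 2 by rewrite real_normK// num_real.
have [ms|ms] := leP (8 * m1 ^+ 2) s.
  have [mK|mK] := leP (m1 * K) 2^-1; last by right; apply: (K2 m1).
  left; have := H m1 m10 mK ms (Hm1 m1 (lexx _)).
  rewrite X2 hc_constE /m1; lra.
pose m3 := Num.sqrt (s / 8).
have m32 : m3 ^+ 2 = s / 8 by rewrite sqr_sqrtr//; lra.
have m30 : 0 < m3 by rewrite sqrtr_gt0; lra.
have m3s : 8 * m3 ^+ 2 <= s by rewrite m32; lra.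
have m31 : m3 <= m1.
  rewrite -(@ler_pXn2r _ 2)// ?nnegrE// ?ltW// m32; lra.
have [mK|mK] := leP (m3 * K) 2^-1; last by right; exact: (K2 m3 (ltW m30)).
left; have h := H m3 (ltW m30) mK m3s (Hm1 m3 m31).
have : (m3 * `|X|) ^+ 2 <= (30 * d) ^+ 2.
  by rewrite lerXn2r// nnegrE mulr_ge0// ltW.
rewrite !exprMn m32 X2 => h2.
have : d ^+ 2 <= d by rewrite expr2 ler_piMl.
rewrite hc_constE; move: h2; clear; lra.
Qed.

Lemma mean_norm_trunc F K : bmfun F -> (forall x, 0 <= F x) -> 0 <= K ->
  `|\int[gauss]_x (F x * trunc K x)| <= K * \int[gauss]_x F x.
Proof.
move=> bF F0 K0; have bt := bmfun_trunc K0; have bFt := bmfunM bF bt.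
rewrite ler_norml -mulNr -!meanZl//; apply/andP; split; apply: le_mean => //.
- by apply: bmfunM => //; exact: bmfun_cst.
- by move=> x; rewrite mulrC ler_wpM2l//; have := trunc_le x K0;
  rewrite ler_norml => /andP[].
- by apply: bmfunM => //; exact: bmfun_cst.
- by move=> x; rewrite mulrC ler_wpM2r//; have := trunc_le x K0;
  rewrite ler_norml => /andP[].
Qed.

(** When both moments are controlled through their squares, the bound is the
inequality between arithmetic and geometric means of [d] and [e].  Otherwise one
moment is linear in its deficit, and the trivial bound by the truncation level
suffices for the other one. *)
Lemma deficit_product (M r s t K L X Y d e : R) :
  1 <= M -> 0 <= r -> 0 < s -> 0 < t -> 0 <= K -> 0 <= L ->
  0 <= d <= 1 -> 0 <= e <= 1 ->
  M * (r * K * L) <= 1 -> (M * r) ^+ 2 <= s * t ->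
  `|X| <= K -> `|Y| <= L ->
  s * X ^+ 2 <= M * d \/ `|X| <= M * K * d ->
  t * Y ^+ 2 <= M * e \/ `|Y| <= M * L * e ->
  (1 - d) * (1 - e) <= 1 + r * X * Y.
Proof.
move=> M1 r0 s0 t0 K0 L0 /andP[d0 d1] /andP[e0 e1] rKL rst XK YL HX HY.
have M0 : 0 < M by exact: lt_le_trans M1.
have de1 : d <= d + e - d * e.
  by rewrite -addrA lerDl subr_ge0 ler_piMl.
have de2 : e <= d + e - d * e.
  by rewrite addrAC lerDr subr_ge0 ler_piMr.
suff H : r * (`|X| * `|Y|) <= d + e - d * e.
  have : - (r * (`|X| * `|Y|)) <= r * X * Y.
    by rewrite -normrM -mulrN -mulrA ler_wpM2l// lerNl -normrN ler_norm.
  move: H; clear; set a := r * (_ * _); set b := r * X * Y; lra.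
have [X2|X1] := HX; last first.
  apply: le_trans de1.
  apply: (@le_trans _ _ (r * ((M * K * d) * L))).
    by rewrite ler_wpM2l// ler_pM.
  rewrite (_ : r * _ = M * (r * K * L) * d); last by clear; ring.
  by rewrite ler_piMl.
have [Y2|Y1] := HY; last first.
  apply: le_trans de2.
  apply: (@le_trans _ _ (r * (K * (M * L * e)))).
    by rewrite ler_wpM2l// ler_pM.
  rewrite (_ : r * _ = M * (r * K * L) * e); last by clear; ring.
  by rewrite ler_piMl.
set z := r * _; have z0 : 0 <= z by rewrite /z !mulr_ge0.
have z2 : z ^+ 2 <= d * e.
  rewrite -(@ler_pM2l _ (M ^+ 2)) ?exprn_gt0//.
  have -> : M ^+ 2 * z ^+ 2 = (M * r) ^+ 2 * (X ^+ 2 * Y ^+ 2).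
    by rewrite /z !exprMn !real_normK ?num_real//; ring.
  have XY0 : 0 <= X ^+ 2 * Y ^+ 2 by rewrite mulr_ge0// sqr_ge0.
  apply: le_trans (ler_wpM2r XY0 rst) _.
  rewrite [leLHS](_ : _ = (s * X ^+ 2) * (t * Y ^+ 2)); last by clear; ring.
  rewrite [leRHS](_ : _ = (M * d) * (M * e)); last by clear; ring.
  by rewrite ler_pM// mulr_ge0 ?sqr_ge0// ltW.
have z3 : z <= (d + e) / 2.
  rewrite -(@ler_pXn2r _ 2)// ?nnegrE//; last first.
    by rewrite divr_ge0// addr_ge0.
  apply: le_trans z2 _; have := sqr_ge0 (d - e); clear; lra.
apply: le_trans z3 _.
move: de1 de2; clear; set a := _ - _; lra.
Qed.

(** For admissible [r] this is the density, with respect to the product of two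
standard Gaussians, of a pair of correlated standard Gaussians (a Sarmanov
distribution).  Unlike the bivariate Gaussian density it is affine in [r]. *)
Definition pair_density K L r (x y : R) : R := 1 + r * trunc K x * trunc L y.

Lemma bmfun_pair_density K L r : 0 <= K -> 0 <= L ->
  bmfun (fun z : measurableTypeR R * measurableTypeR R => pair_density K L r
    z.1 z.2).
Proof.
move=> K0 L0; apply: bmfunD; first exact: bmfun_cst.
apply: bmfunM; last exact: (bmfun_comp (bmfun_trunc L0) measurable_snd).
apply: bmfunM; first exact: bmfun_cst.
exact: (bmfun_comp (bmfun_trunc K0) measurable_fst).
Qed.

Lemma mean_pair_density F G K L r : bmfun F -> bmfun G -> 0 <= K -> 0 <= L ->
  \int[gauss]_x \int[gauss]_y (F x * G y * pair_density K L r x y) =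
  \int[gauss]_x F x * \int[gauss]_y G y +
  r * \int[gauss]_x (F x * trunc K x) * \int[gauss]_y (G y * trunc L y).
Proof.
move=> bF bG K0 L0.
have bt := bmfun_trunc K0; have bu := bmfun_trunc L0.
have bFt := bmfunM bF bt; have bGu := bmfunM bG bu.
transitivity (\int[gauss]_x (F x * \int[gauss]_y G y +
   (F x * trunc K x) * (r * \int[gauss]_y (G y * trunc L y)))).
  apply: eq_Rintegral => x _.
  have bc c (H : measurableTypeR R -> R) : bmfun H -> bmfun (fun y => c * H y).
    by move=> bH; apply: bmfunM => //; exact: bmfun_cst.
  rewrite -meanZl// -meanZl// -meanZl; last exact: bc.
  rewrite -meanD; [|exact: bc|by do 2 apply: (bc)].
  by apply: eq_Rintegral => y _; rewrite /pair_density; ring.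
rewrite meanD; [|by apply: bmfunM => //; exact: bmfun_cst..].
by rewrite !meanZr//; ring.
Qed.

Lemma mean_powR_eq0 F p : p != 0 -> bmfun F -> (forall x, 0 <= F x) ->
  \int[gauss]_x F x = 0 -> \int[gauss]_x (F x `^ p) = 0.
Proof.
move=> p0 bF F0 EF0.
have : (\int[gauss]_x `|(F x)%:E| = 0)%E.
  rewrite -[RHS]/(0%:E) -EF0 EFin_mean//; apply: eq_integral => x _.
  by rewrite gee0_abs// lee_fin.
have mF : measurable_fun setT (EFin \o F) by apply/measurable_EFinP;
  exact: bF.1.
move=> /(ae_eq_integral_abs gauss measurableT mF) aeF.
rewrite /Rintegral (_ : (\int[gauss]_x (F x `^ p)%:E)%E = 0%E)//.
rewrite (@ae_eq_integral _ _ _ gauss setT (cst 0%E)) ?integral0//.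
- apply/measurable_EFinP; exact: (measurableT_comp (measurable_powR _) bF.1).
- apply: filterS aeF => x /= Fx _; have := Fx Logic.I => -[->].
  by rewrite powR0.
Qed.

Lemma powR_le_id (u p : R) : 0 <= u <= 1 -> 1 <= p -> u `^ p <= u.
Proof.
move=> /andP[]; rewrite le_eqVlt => /predU1P[<- _ p1|u0 u1 p1].
  by rewrite powR0// gt_eqF// (lt_le_trans _ p1).
by rewrite ge1r_powR// u0.
Qed.

Lemma normalized_deficit F s K (f := \int[gauss]_x F x) : bmfun F ->
  (forall x, 0 <= F x) -> 0 < s -> s <= 2^-1 -> 0 <= K -> 0 < f ->
  exists X d, [/\ 0 <= d <= 1, `|X| <= K,
    \int[gauss]_x (F x * trunc K x) = f * X,
    (\int[gauss]_x (F x `^ (1 - s))) `^ (1 - s)^-1 <= f * (1 - d) &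
    s * X ^+ 2 <= hc_const * d \/ `|X| <= hc_const * K * d].
Proof.
move=> bF F0 s0 s2 K0 f0.
have p0 : 0 < 1 - s by lra.
pose Fn x := f^-1 * F x.
have bFn : bmfun (Fn : measurableTypeR R -> R).
  by apply: bmfunM => //; exact: bmfun_cst.
have if0 : 0 <= f^-1 by rewrite invr_ge0 ltW.
have Fn0 x : 0 <= Fn x by rewrite mulr_ge0.
have Fn1 : \int[gauss]_x Fn x = 1 by rewrite meanZl// mulVf// gt_eqF.
have bFt := bmfunM bF (bmfun_trunc K0).
have XE : \int[gauss]_x (F x * trunc K x) = f * \int[gauss]_x (Fn x * trunc K
  x).
  rewrite -meanZl; last by apply: bmfunM => //; exact: bmfun_trunc.
  by apply: eq_Rintegral => x _; rewrite /Fn; field; rewrite gt_eqF.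
exists (\int[gauss]_x (Fn x * trunc K x)), (1 - \int[gauss]_x (Fn x `^ (1 -
  s))).
split => //.
- by rewrite deficit_ge0//; exact: deficit_le1.
- by have := mean_norm_trunc bFn Fn0 K0; rewrite Fn1 mulr1.
- rewrite subKr.
  have bFnp : bmfun (fun x => Fn x `^ (1 - s)) by apply: bmfun_powR => //;
    exact: ltW.
  have -> : \int[gauss]_x (F x `^ (1 - s)) =
      f `^ (1 - s) * \int[gauss]_x (Fn x `^ (1 - s)).
    rewrite -meanZl//; apply: eq_Rintegral => x _.
    by rewrite -powRM; [rewrite /Fn mulVKf// gt_eqF|exact: ltW|exact: Fn0].
  rewrite powRM ?powR_ge0//; last by apply: mean_ge0 => x; exact: powR_ge0.
  rewrite -powRrM mulfV ?gt_eqF// (powRr1 (ltW f0)) ler_pM2l//.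
  apply: powR_le_id; last by rewrite invf_ge1//; lra.
  rewrite mean_ge0/=; last by move=> x; exact: powR_ge0.
  by have := deficit_ge0 s0 s2 bFn Fn0 Fn1; rewrite subr_ge0.
- exact: moment_dichotomy.
Qed.

(** When [F] and [G] have mean 1, the right-hand side is [1 + r * X * Y] with [X]
and [Y] their truncated moments, and the left-hand side is at most the product
of the complements of their deficits: this is [deficit_product]. *)
Lemma reverse_hypercontractive_line F G r s t K L :
  bmfun F -> bmfun G -> (forall x, 0 <= F x) -> (forall y, 0 <= G y) ->
  0 <= r -> 0 < s <= 2^-1 -> 0 < t <= 2^-1 -> 0 <= K -> 0 <= L ->
  hc_const * (r * K * L) <= 1 -> (hc_const * r) ^+ 2 <= s * t ->
  (\int[gauss]_x (F x `^ (1 - s))) `^ (1 - s)^-1 *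
  (\int[gauss]_y (G y `^ (1 - t))) `^ (1 - t)^-1 <=
  \int[gauss]_x \int[gauss]_y (F x * G y * pair_density K L r x y).
Proof.
move=> bF bG F0 G0 r0 /andP[s0 s2] /andP[t0 t2] K0 L0 rKL rst.
rewrite mean_pair_density//.
have p0 : 0 < 1 - s by lra.
have q0 : 0 < 1 - t by lra.
have ip0 : (1 - s)^-1 != 0 by rewrite invr_eq0 gt_eqF.
have iq0 : (1 - t)^-1 != 0 by rewrite invr_eq0 gt_eqF.
have XK := mean_norm_trunc bF F0 K0.
have YL := mean_norm_trunc bG G0 L0.
set f := \int[gauss]_x F x in XK *; set g := \int[gauss]_y G y in YL *.
have [f0|f0] := eqVneq f 0.
  rewrite (mean_powR_eq0 _ bF F0 f0) ?gt_eqF// powR0// f0 !mul0r add0r.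
  by move: XK; rewrite f0 mulr0 normr_le0 => /eqP ->; rewrite mulr0 mul0r.
have [g0|g0] := eqVneq g 0.
  rewrite (mean_powR_eq0 _ bG G0 g0) ?gt_eqF// powR0// g0 !mulr0 add0r.
  by move: YL; rewrite g0 mulr0 normr_le0 => /eqP ->; rewrite mulr0.
have fp : 0 < f by rewrite lt_neqAle eq_sym f0 mean_ge0.
have gp : 0 < g by rewrite lt_neqAle eq_sym g0 mean_ge0.
have [X [d [d01 XK' XE Fp HX]]] := normalized_deficit bF F0 s0 s2 K0 fp.
have [Y [e [e01 YL' YE Gq HY]]] := normalized_deficit bG G0 t0 t2 L0 gp.
rewrite XE YE -/f -/g.
have := deficit_product hc_const_ge1 r0 s0 t0 K0 L0 d01 e01 rKL rst XK' YL' HX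
  HY.
move=> h; apply: le_trans (ler_pM (powR_ge0 _ _) (powR_ge0 _ _) Fp Gq) _.
rewrite (_ : f * g + _ = (f * g) * (1 + r * X * Y)); last by ring.
by rewrite mulrACA ler_pM2l// mulr_gt0.
Qed.

End reverse_hypercontractivity.

(** * Coupled Gaussian vectors *)

Section gaussian_space.
Context {R : realType}.
Local Notation gauss := (gauss R).
Local Notation gpow := (gauss_power R).
Local Notation T := (measurableTypeR R).
Implicit Types n : nat.

Lemma mean_power_cons n (f : n.+1.-tuple T -> R) : bmfun f ->
  \int[gpow n.+1]_X f X = \int[gauss]_x \int[gpow n]_t f (cons_pair (x, t)).
Proof.
move=> bf.
have bc : bmfun (f \o @cons_pair _ T n) :=
  bmfun_comp bf (@measurable_cons_pair _ T n).
have bc' : bmfun (fun z : T * n.-tuple T => f (cons_pair (z.1, z.2))).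
  by rewrite (_ : (fun _ => _) = f \o @cons_pair _ T n)//; apply/funext => -[].
rewrite -(mean_prod gauss (gpow n) bc').
rewrite /Rintegral; congr fine.
transitivity (\int[pushforward (gauss \x gpow n)
  (@cons_pair _ T n)]_X (f X)%:E)%E.
  by apply: eq_measure_integral.
rewrite integral_pushforward//=.
- by apply/measurable_EFinP; exact: bf.1.
- exact: (bmfun_integrable _ bc).
Qed.

Lemma bmfun_mean_joint d1 d2 d3 (T1 : measurableType d1)
  (T2 : measurableType d2)
    (T3 : measurableType d3) (P1 : probability T1 R) (P2 : probability T2 R)
    (P3 : probability T3 R) (f : T1 -> T2 -> T3 -> R) :
  bmfun (fun z : T1 * T2 * T3 => f z.1.1 z.1.2 z.2) ->
  bmfun (fun z : T1 * T2 => \int[P3]_w f z.1 z.2 w).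
Proof.
move=> bf.
exact: (@bmfun_mean _ _ _ _ _ (P1 \x P2)%E P3 (fun z w => f z.1 z.2 w) bf).
Qed.

Section double_integral.
Variable n : nat.
Variable f : n.+1.-tuple T -> n.+1.-tuple T -> R.
Hypothesis bf : bmfun (fun z => f z.1 z.2).

Lemma bmfun_cons4 : bmfun (fun z : T * T * n.-tuple T * n.-tuple T =>
  f (cons_pair (z.1.1.1, z.1.2)) (cons_pair (z.1.1.2, z.2))).
Proof.
apply: (bmfun_comp bf (g := fun z : T * T * n.-tuple T * n.-tuple T =>
  (cons_pair (z.1.1.1, z.1.2), cons_pair (z.1.1.2, z.2)))).
have m1 : measurable_fun setT (fun z : T * T * n.-tuple T * n.-tuple T =>
  z.1.1).
  exact: (measurableT_comp measurable_fst measurable_fst).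
apply: measurable_fun_pair; apply: measurable_cons => //=.
- exact: (measurableT_comp measurable_fst m1).
- exact: (measurableT_comp measurable_snd measurable_fst).
- exact: (measurableT_comp measurable_snd m1).
- exact: measurable_snd.
Qed.

Lemma bmfun_mean_cons2 : bmfun (fun z : T * T => \int[gpow n]_t \int[gpow n]_u
  f (cons_pair (z.1, t)) (cons_pair (z.2, u))).
Proof.
apply: (@bmfun_mean_joint _ _ _ _ _ _ gauss gauss (gpow n)
  (fun x y t => \int[gpow n]_u f (cons_pair (x, t)) (cons_pair (y, u)))).
apply: (@bmfun_mean _ _ _ _ _ ((gauss \x gauss) \x gpow n)%E (gpow n)
  (fun z u => f (cons_pair (z.1.1, z.2)) (cons_pair (z.1.2, u)))).
exact: bmfun_cons4.
Qed.

Lemma mean_power_cons2 :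
  \int[gpow n.+1]_X \int[gpow n.+1]_Y f X Y =
  \int[gauss]_x \int[gauss]_y \int[gpow n]_t \int[gpow n]_u
    f (cons_pair (x, t)) (cons_pair (y, u)).
Proof.
rewrite mean_power_cons; last exact: (bmfun_mean (gpow n.+1) (gpow n.+1) bf).
apply: eq_Rintegral => x _.
transitivity (\int[gpow n]_t \int[gauss]_y \int[gpow n]_u
    f (cons_pair (x, t)) (cons_pair (y, u))).
  apply: eq_Rintegral => t _.
  by rewrite mean_power_cons//; exact: bmfun_section1 bf _.
rewrite (@mean_swap _ _ _ _ _ (gpow n) gauss (fun t y => \int[gpow n]_u
    f (cons_pair (x, t)) (cons_pair (y, u))))//.
apply: (@bmfun_mean_joint _ _ _ _ _ _ (gpow n) gauss (gpow n)
  (fun t y u => f (cons_pair (x, t)) (cons_pair (y, u)))).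
apply: (bmfun_comp bf (g := fun z : n.-tuple T * T * n.-tuple T =>
  (cons_pair (x, z.1.1), cons_pair (z.1.2, z.2)))).
apply: measurable_fun_pair; apply: measurable_cons => //=.
- exact: (measurableT_comp measurable_fst measurable_fst).
- exact: (measurableT_comp measurable_snd measurable_fst).
- exact: measurable_snd.
Qed.

End double_integral.

Definition coupling_density n (K L r : 'I_n -> R) (X Y : n.-tuple T) : R :=
  \prod_j pair_density (K j) (L j) (r j) (tnth X j) (tnth Y j).

Lemma bmfun_coupling_density n (K L r : 'I_n -> R) :
  (forall j, 0 <= K j) -> (forall j, 0 <= L j) ->
  bmfun (fun z : n.-tuple T * n.-tuple T => coupling_density K L r z.1 z.2).
Proof.
move=> K0 L0; apply: bmfun_prod => j.
apply: (bmfun_comp (bmfun_pair_density (r j) (K0 j) (L0 j))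
  (g := fun z : n.-tuple T * n.-tuple T => (tnth z.1 j, tnth z.2 j))).
apply: measurable_fun_pair.
- exact: (measurableT_comp (measurable_tnth j) measurable_fst).
- exact: (measurableT_comp (measurable_tnth j) measurable_snd).
Qed.

Lemma coupling_density_cons n (K L r : 'I_n.+1 -> R) x y (t u : n.-tuple T) :
  coupling_density K L r (cons_pair (x, t)) (cons_pair (y, u)) =
  pair_density (K ord0) (L ord0) (r ord0) x y *
  coupling_density (K \o lift ord0) (L \o lift ord0) (r \o lift ord0) t u.
Proof.
rewrite /coupling_density big_ord_recl /=; congr (_ * _).
by apply: eq_bigr => j _; rewrite !tnthS.
Qed.

Lemma pair_density_ge0 K L r (x y : R) : 0 <= K -> 0 <= L -> 0 <= r ->
  r * K * L <= 1 -> 0 <= pair_density K L r x y.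
Proof.
move=> K0 L0 r0 rKL; rewrite /pair_density -[X in 0 <= _ + X]opprK subr_ge0.
apply: le_trans (ler_norm _) _; rewrite normrN !normrM (ger0_norm r0).
by apply: le_trans rKL; rewrite ler_pM ?mulr_ge0 ?ler_wpM2l// trunc_le.
Qed.

Lemma coupling_density_ge0 n (K L r : 'I_n -> R) X Y : (forall j, 0 <= K j) ->
  (forall j, 0 <= L j) -> (forall j, 0 <= r j) ->
  (forall j, r j * K j * L j <= 1) -> 0 <= coupling_density K L r X Y.
Proof. by move=> K0 L0 r0 rKL; apply: prodr_ge0 => j _;
  exact: pair_density_ge0. Qed.

Lemma mean_point (f : 0.-tuple T -> R) : \int[gpow 0]_X f X = f [tuple].
Proof.
rewrite -[RHS](mean_cst (gpow 0)); apply: eq_Rintegral => x _.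
by rewrite (tuple0 x).
Qed.

(** The norms of the sections of [F] and [G] at their first coordinates are
functions on the line, to which [reverse_hypercontractive_line] applies; the
norm of the norms of the sections is the norm of the function. *)
Lemma reverse_hypercontractive n (K L r : 'I_n -> R) (s s' : R)
    (F G : n.-tuple T -> R) :
  bmfun F -> bmfun G -> (forall x, 0 <= F x) -> (forall y, 0 <= G y) ->
  0 < s <= 2^-1 -> 0 < s' <= 2^-1 ->
  (forall j, 0 <= K j) -> (forall j, 0 <= L j) -> (forall j, 0 <= r j) ->
  (forall j, hc_const * (r j * K j * L j) <= 1) ->
  (forall j, (hc_const * r j) ^+ 2 <= s * s') ->
  (\int[gpow n]_X (F X `^ (1 - s))) `^ (1 - s)^-1 *
  (\int[gpow n]_Y (G Y `^ (1 - s'))) `^ (1 - s')^-1 <=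
  \int[gpow n]_X \int[gpow n]_Y (F X * G Y * coupling_density K L r X Y).
Proof.
move=> + + + + s02 s02'.
have [s0 s2] := andP s02; have [s0' s2'] := andP s02'.
have p0 : 0 < 1 - s by clear -s2; lra.
have q0 : 0 < 1 - s' by clear -s2'; lra.
elim: n K L r F G => [|n IH] K L r F G bF bG F0 G0 K0 L0 r0 rKL rst.
  by rewrite !mean_point /coupling_density big_ord0 -!powRrM !mulfV ?gt_eqF//
    !powRr1// mulr1.
have rKL1 j : r j * K j * L j <= 1.
  apply: le_trans (rKL j); rewrite ler_peMl//; last exact: hc_const_ge1.
  by rewrite !mulr_ge0.
pose Fp x := (\int[gpow n]_t (F (cons_pair (x, t)) `^ (1 - s))) `^ (1 - s)^-1.
pose Gq y := (\int[gpow n]_t (G (cons_pair (y, t)) `^ (1 - s'))) `^ (1 - s')^-1.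
have bpow (H : n.+1.-tuple T -> R) p : 0 < p -> bmfun H ->
  (forall X, 0 <= H X) ->
    bmfun (fun z : T * n.-tuple T => H (cons_pair (z.1, z.2)) `^ p).
  move=> p0' bH H0; apply: bmfun_powR => //; first exact: ltW.
  apply: (bmfun_comp bH (g := fun z : T * n.-tuple T => cons_pair (z.1, z.2))).
  by apply: measurable_cons; [exact: measurable_fst|exact: measurable_snd].
have bn (H : n.+1.-tuple T -> R) p : 0 < p -> bmfun H -> (forall X, 0 <= H X) ->
    bmfun (fun x : T => (\int[gpow n]_t (H (cons_pair (x, t)) `^ p)) `^ p^-1).
  move=> p0' bH H0; apply: bmfun_powR.
  - by rewrite invr_ge0 ltW.
  - by move=> x; apply: mean_ge0 => t; exact: powR_ge0.
  - apply: (@bmfun_mean _ _ _ _ _ gauss (gpow n)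
    (fun x t => H (cons_pair (x, t)) `^ p)).
    exact: bpow.
have ball (H : n.+1.-tuple T -> R) p : 0 < p -> bmfun H ->
  (forall X, 0 <= H X) ->
    \int[gpow n.+1]_X (H X `^ p) =
    \int[gauss]_x (((\int[gpow n]_t (H (cons_pair (x, t)) `^ p)) `^ p^-1) `^ p).
  move=> p0' bH H0; rewrite mean_power_cons;
    last exact: bmfun_powR (ltW p0') H0 bH.
  apply: eq_Rintegral => x _; rewrite -powRrM mulVf ?gt_eqF// powRr1//.
  by apply: mean_ge0 => t; exact: powR_ge0.
rewrite (ball F)// (ball G)//.
have := @reverse_hypercontractive_line R Fp Gq (r ord0) s s' (K ord0) (L ord0)
  (bn F _ p0 bF F0) (bn G _ q0 bG G0) (fun x => powR_ge0 _ _)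
    (fun x => powR_ge0 _ _)
  (r0 _) s02 s02' (K0 _) (L0 _) (rKL _) (rst _).
move=> /le_trans; apply.
have bPhi : bmfun (fun z : n.+1.-tuple T * n.+1.-tuple T =>
    F z.1 * G z.2 * coupling_density K L r z.1 z.2).
  apply: bmfunM; last exact: bmfun_coupling_density.
  by apply: bmfunM; [exact: (bmfun_comp bF measurable_fst)|
                     exact: (bmfun_comp bG measurable_snd)].
rewrite (@mean_power_cons2 n (fun X Y => F X * G Y * coupling_density K L r X
  Y) bPhi).
have bI := @bmfun_mean_cons2 n (fun X Y => F X * G Y * coupling_density K L r X
  Y) bPhi.
pose J (x y : T) := Fp x * Gq y * pair_density (K ord0) (L ord0) (r ord0) x y.
pose I (x y : T) := \int[gpow n]_t \int[gpow n]_u (F (cons_pair (x, t)) *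
  G (cons_pair (y, u)) * coupling_density K L r (cons_pair (x, t))
    (cons_pair (y, u))).
have bJ : bmfun (fun z : T * T => J z.1 z.2).
  apply: bmfunM; last exact: bmfun_pair_density.
  by apply: bmfunM; [exact: (bmfun_comp (bn F _ p0 bF F0) measurable_fst)|
                     exact: (bmfun_comp (bn G _ q0 bG G0) measurable_snd)].
apply: le_mean => [||x].
- exact: (@bmfun_mean _ _ _ _ _ gauss gauss J bJ).
- exact: (@bmfun_mean _ _ _ _ _ gauss gauss I bI).
apply: le_mean => [||y].
- exact: (@bmfun_section1 _ _ _ _ _ J bJ x).
- exact: (@bmfun_section1 _ _ _ _ _ I bI x).
have bFx : bmfun (fun t : n.-tuple T => F (cons_pair (x, t))).
  by apply: (bmfun_comp bF (g := fun t => cons_pair (x, t)));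
    apply: measurable_cons; [exact: measurable_cst|exact: measurable_id].
have bGy : bmfun (fun t : n.-tuple T => G (cons_pair (y, t))).
  by apply: (bmfun_comp bG (g := fun t => cons_pair (y, t)));
    apply: measurable_cons; [exact: measurable_cst|exact: measurable_id].
have b0 : 0 <= pair_density (K ord0) (L ord0)
  (r ord0) x y by exact: pair_density_ge0.
have IHxy := IH (K \o lift ord0) (L \o lift ord0) (r \o lift ord0) _ _
  bFx bGy (fun _ => F0 _) (fun _ => G0 _) (fun _ => K0 _) (fun _ => L0 _)
  (fun _ => r0 _) (fun _ => rKL _) (fun _ => rst _).
apply: le_trans (ler_wpM2r b0 IHxy) _.
have bk := bmfun_coupling_density (r \o lift ord0) (fun j => K0 (lift ord0 j))
  (fun j => L0 (lift ord0 j)).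
pose Q (t u : n.-tuple T) := F (cons_pair (x, t)) * G (cons_pair (y, u)) *
   coupling_density (K \o lift ord0) (L \o lift ord0) (r \o lift ord0) t u.
have bQ : bmfun (fun z : n.-tuple T * n.-tuple T => Q z.1 z.2).
  apply: bmfunM => //.
  by apply: bmfunM; [exact: (bmfun_comp bFx measurable_fst)|
                     exact: (bmfun_comp bGy measurable_snd)].
rewrite -meanZr; last exact: (@bmfun_mean _ _ _ _ _ (gpow n) (gpow n) Q bQ).
rewrite le_eqVlt; apply/orP; left; apply/eqP; apply: eq_Rintegral => t _.
rewrite -meanZr; last exact: (@bmfun_section1 _ _ _ _ _ Q bQ t).
by apply: eq_Rintegral => u _; rewrite coupling_density_cons; ring.
Qed.

End gaussian_space.

(** * Increasing sets *)

Section increasing_sets.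
Context {R : realType}.
Local Notation gauss := (gauss R).
Local Notation gpow := (gauss_power R).
Local Notation T := (measurableTypeR R).
Implicit Types n : nat.

Lemma tnth_update n (i j : 'I_n) (X : n.-tuple T) (y : R) :
  tnth (update i X y) j = if j == i then y else tnth X j.
Proof. by rewrite tnth_mktuple. Qed.

Lemma tnth_consS n (x : T) (t : n.-tuple T) j :
  tnth (cons_pair (x, t)) (lift ord0 j) = tnth t j.
Proof. by rewrite tnthS. Qed.

Lemma update_cons0 n (x : T) (t : n.-tuple T) (y : R) :
  update ord0 (cons_pair (x, t)) y = cons_pair (y : T, t).
Proof.
apply: eq_from_tnth => j; rewrite tnth_update.
case: (unliftP ord0 j) => [k|] ->; last by rewrite eqxx.
by rewrite eq_sym (negbTE (neq_lift _ _)) !tnth_consS.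
Qed.

Lemma update_consS n i (x : T) (t : n.-tuple T) (y : R) :
  update (lift ord0 i) (cons_pair (x, t)) y = cons_pair (x, update i t y).
Proof.
apply: eq_from_tnth => j; rewrite tnth_update.
case: (unliftP ord0 j) => [k|] ->; last by rewrite (negbTE (neq_lift _ _)).
by rewrite !tnth_consS tnth_update (inj_eq lift_inj).
Qed.

Lemma upset_fiber n (A : set (n.-tuple T)) i X :
  increasing A -> upset (fiber A i X).
Proof.
move=> incA s t /= As st; have := incA i X s t st.
rewrite !indicE mem_set// ler1n lt0b; exact: set_mem.
Qed.

Lemma increasing_section n (A : set (n.+1.-tuple T)) x :
  increasing A -> increasing [set t | A (cons_pair (x, t))].
Proof.
move=> incA i t s s' ss'; have := incA (lift ord0 i)
  (cons_pair (x, t)) s s' ss'.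
by rewrite !update_consS !indicE.
Qed.

Lemma upset_head n (A : set (n.+1.-tuple T)) t :
  increasing A -> upset [set x : R | A (cons_pair (x : T, t))].
Proof.
move=> incA x y /= Ax xy; have :=
  @upset_fiber _ _ ord0 (cons_pair (x : T, t)) incA x y.
by rewrite /fiber/= !update_cons0; exact.
Qed.

Lemma upset_total (U V : set R) : upset U -> upset V -> U `<=` V \/ V `<=` U.
Proof.
move=> uU uV; apply: contrapT => /not_orP[/existsNP[u /not_implyP[Uu nVu]]].
apply => v Vv; have [vu|/ltW uv] := leP v u; first by case: nVu;
  exact: uV Vv vu.
exact: uU Uu uv.
Qed.

(** One of the two sets contains the other.  Replacing the larger one by the
whole line leaves a marginal probability, because the truncated identity has
mean zero. *)
Lemma pair_density_diagonal_le K L r (U V : set R) :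
  0 <= K -> 0 <= L -> 0 <= r -> r * K * L <= 1 -> upset U -> upset V ->
  \int[gauss]_x \int[gauss]_y (\1_U x * \1_V y * pair_density K L r x y) <=
  \int[gauss]_x (\1_U x * \1_V x).
Proof.
move=> K0 L0 r0 rKL uU uV.
have bU : bmfun (\1_U : T -> R) by apply: bmfun_indic; exact: upset_measurable.
have bV : bmfun (\1_V : T -> R) by apply: bmfun_indic; exact: upset_measurable.
have b1 : bmfun (\1_setT : T -> R) by exact: bmfun_indic.
have bb := bmfun_pair_density r K0 L0.
have bFG (F G : T -> R) : bmfun F -> bmfun G ->
    bmfun (fun z : T * T => F z.1 * G z.2 * pair_density K L r z.1 z.2).
  move=> bF bG; apply: bmfunM => //.
  by apply: bmfunM; [exact: (bmfun_comp bF measurable_fst)|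
                     exact: (bmfun_comp bG measurable_snd)].
have mono (F F' G G' : T -> R) : bmfun F -> bmfun F' -> bmfun G -> bmfun G' ->
    (forall x y, F x * G y <= F' x * G' y) ->
    \int[gauss]_x \int[gauss]_y (F x * G y * pair_density K L r x y) <=
    \int[gauss]_x \int[gauss]_y (F' x * G' y * pair_density K L r x y).
  move=> bF bF' bG bG' FG.
  apply: le_mean => [||x].
  - exact: (@bmfun_mean _ _ _ _ _ gauss gauss (fun x y => F x * G y *
    pair_density K L r x y) (bFG _ _ bF bG)).
  - exact: (@bmfun_mean _ _ _ _ _ gauss gauss (fun x y => F' x * G' y *
    pair_density K L r x y) (bFG _ _ bF' bG')).
  apply: le_mean => [||y].
  - exact: (@bmfun_section1 _ _ _ _ _ (fun x y => F x * G y * pair_density K L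
    r x y) (bFG _ _ bF bG) x).
  - exact: (@bmfun_section1 _ _ _ _ _ (fun x y => F' x * G' y * pair_density K
    L r x y) (bFG _ _ bF' bG') x).
  by rewrite ler_wpM2r// pair_density_ge0.
have i01 (W : set R) x : 0 <= (\1_W x : R) <= 1.
  by rewrite indicE ler0n lern1 leq_b1.
have t1 := tail_mean_setT K0; have t2 := tail_mean_setT L0.
rewrite /tail_mean in t1 t2.
have mT : \int[gauss]_x \1_(setT : set R) x = 1.
  by rewrite mean_indic//= probability_setT.
have [UV|VU] := upset_total uU uV.
  apply: (@le_trans _ _ (\int[gauss]_x \int[gauss]_y (\1_U x * \1_setT y *
    pair_density K L r x y))).
    by apply: mono => // x y; have /andP[? ?] := i01 U x; have /andP[? ?] :=
      i01 V y;
       rewrite indicT ler_wpM2l.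
  rewrite mean_pair_density// t2 mT mulr0 addr0 mulr1 le_eqVlt; apply/orP; left.
  apply/eqP/eq_Rintegral => x _; rewrite !indicE.
  have [/set_mem Ux|_] := boolP (x \in U); last by rewrite mul0r.
  by rewrite (mem_set (UV _ Ux)) mulr1.
apply: (@le_trans _ _ (\int[gauss]_x \int[gauss]_y (\1_setT x * \1_V y *
  pair_density K L r x y))).
  by apply: mono => // x y; have /andP[? ?] := i01 U x; have /andP[? ?] :=
    i01 V y;
     rewrite indicT ler_wpM2r.
rewrite mean_pair_density// t1 mT mulr0 mul0r addr0 mul1r le_eqVlt; apply/orP;
  left.
apply/eqP/eq_Rintegral => x _; rewrite !indicE.
have [/set_mem Vx|_] := boolP (x \in V); last by rewrite mulr0.
by rewrite (mem_set (VU _ Vx)) mulr1.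
Qed.

(** Given the first coordinates, the induction hypothesis identifies the other
coordinates of the two vectors; given these, [pair_density_diagonal_le]
identifies the first ones. *)
Lemma mean_coupling_density_le_diagonal n (K L r : 'I_n -> R)
  (A B : set (n.-tuple T)) :
  (forall j, 0 <= K j) -> (forall j, 0 <= L j) -> (forall j, 0 <= r j) ->
  (forall j, r j * K j * L j <= 1) ->
  measurable A -> measurable B -> increasing A -> increasing B ->
  \int[gpow n]_X \int[gpow n]_Y (\1_A X * \1_B Y * coupling_density K L r X Y)
    <=
  \int[gpow n]_X (\1_A X * \1_B X).
Proof.
elim: n K L r A B => [|n IH] K L r A B K0 L0 r0 rKL mA mB iA iB.
  by rewrite !mean_point /coupling_density big_ord0 mulr1.
have bA := bmfun_indic (R := R) mA; have bB := bmfun_indic (R := R) mB.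
pose Phi X Y := \1_A X * \1_B Y * coupling_density K L r X Y.
have bPhi : bmfun (fun z : n.+1.-tuple T * n.+1.-tuple T => Phi z.1 z.2).
  apply: bmfunM; last exact: bmfun_coupling_density.
  by apply: bmfunM; [exact: (bmfun_comp bA measurable_fst)|
                     exact: (bmfun_comp bB measurable_snd)].
rewrite (mean_power_cons2 bPhi).
have bAB : bmfun (fun X : n.+1.-tuple T => \1_A X * \1_B X : R) by exact:
  bmfunM.
rewrite (mean_power_cons bAB).
pose Ax (x : T) := [set t : n.-tuple T | A (cons_pair (x, t))].
pose Bx (x : T) := [set t : n.-tuple T | B (cons_pair (x, t))].
pose At t := [set x : R | A (cons_pair (x : T, t))].
pose Bt t := [set x : R | B (cons_pair (x : T, t))].
pose b := pair_density (K ord0) (L ord0) (r ord0).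
pose k := coupling_density (K \o lift ord0) (L \o lift ord0) (r \o lift ord0).
have mcons x : measurable_fun setT (fun t : n.-tuple T => cons_pair (x : T, t)).
  by apply: measurable_cons; [exact: measurable_cst|exact: measurable_id].
have mcons2 : measurable_fun setT (fun z : T * n.-tuple T => cons_pair (z.1,
  z.2)).
  by apply: measurable_cons; [exact: measurable_fst|exact: measurable_snd].
have mAx x : measurable (Ax x) by rewrite -[Ax x]setTI;
  exact: (mcons x measurableT _ mA).
have mBx x : measurable (Bx x) by rewrite -[Bx x]setTI;
  exact: (mcons x measurableT _ mB).
pose I (x y : T) := \int[gpow n]_t \int[gpow n]_u
  Phi (cons_pair (x, t)) (cons_pair (y, u)).
have bI : bmfun (fun z : T * T => I z.1 z.2) := bmfun_mean_cons2 bPhi.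
pose J3 (x y : T) (t : n.-tuple T) :=
  \1_A (cons_pair (x, t)) * \1_B (cons_pair (y, t)) * b x y.
have bJ3 : bmfun (fun z : T * T * n.-tuple T => J3 z.1.1 z.1.2 z.2).
  apply: bmfunM; last first.
    exact: (bmfun_comp (bmfun_pair_density (r ord0) (K0 ord0)
      (L0 ord0)) measurable_fst).
  apply: bmfunM.
    apply: (bmfun_comp bA (g := fun z : T * T * n.-tuple T => cons_pair (z.1.1,
      z.2))).
    by apply: measurable_cons; [exact: (measurableT_comp measurable_fst
      measurable_fst)|exact: measurable_snd].
  apply: (bmfun_comp bB (g := fun z : T * T * n.-tuple T => cons_pair (z.1.2,
    z.2))).
  by apply: measurable_cons; [exact: (measurableT_comp measurable_snd
    measurable_fst)|exact: measurable_snd].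
pose J (x y : T) := \int[gpow n]_t J3 x y t.
have bJ : bmfun (fun z : T * T => J z.1 z.2).
  exact: (@bmfun_mean_joint _ _ _ _ _ _ _ gauss gauss (gpow n) J3 bJ3).
have IJ x y : I x y <= J x y.
  have b0 : 0 <= b x y by exact: pair_density_ge0.
  have bAx := bmfun_indic (R := R) (mAx x); have bBy := bmfun_indic (R := R)
    (mBx y).
  have := IH (K \o lift ord0) (L \o lift ord0) (r \o lift ord0) (Ax x) (Bx y)
    (fun _ => K0 _) (fun _ => L0 _) (fun _ => r0 _) (fun _ => rKL _) (mAx x)
      (mBx y)
    (@increasing_section _ A x iA) (@increasing_section _ B y iB).
  move=> /(ler_wpM2r b0).
  rewrite -[X in _ <= X -> _]meanZr; last exact: bmfunM.
  pose Q (t u : n.-tuple T) := \1_(Ax x) t * \1_(Bx y) u * k t u.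
  have bQ : bmfun (fun z : n.-tuple T * n.-tuple T => Q z.1 z.2).
    apply: bmfunM; last first.
      exact: (bmfun_coupling_density _ (fun j => K0 (lift ord0 j))
        (fun j => L0 (lift ord0 j))).
    by apply: bmfunM; [exact: (bmfun_comp bAx measurable_fst)|
                       exact: (bmfun_comp bBy measurable_snd)].
  rewrite -meanZr; last exact: (@bmfun_mean _ _ _ _ _ (gpow n) (gpow n) Q bQ).
  congr (_ <= _); apply: eq_Rintegral => t _.
  rewrite -meanZr; last exact: (@bmfun_section1 _ _ _ _ _ Q bQ t).
  by apply: eq_Rintegral => u _; rewrite /Phi coupling_density_cons !indicE /b;
    ring.
apply: (@le_trans _ _ (\int[gauss]_x \int[gauss]_y J x y)).
  apply: le_mean => [||x].
  - exact: (@bmfun_mean _ _ _ _ _ gauss gauss I bI).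
  - exact: (@bmfun_mean _ _ _ _ _ gauss gauss J bJ).
  apply: le_mean => [||y]; last exact: IJ.
  - exact: (@bmfun_section1 _ _ _ _ _ I bI x).
  - exact: (@bmfun_section1 _ _ _ _ _ J bJ x).
have bJ3xy t : bmfun (fun z : T * T => J3 z.1 z.2 t).
  exact: (@bmfun_section2 _ _ _ _ _ (fun z t => J3 z.1 z.2 t) bJ3 t).
pose D (x : T) (t : n.-tuple T) : R :=
  \1_A (cons_pair (x, t)) * \1_B (cons_pair (x, t)).
have bD : bmfun (fun z : T * n.-tuple T => D z.1 z.2).
  exact: (bmfun_comp bAB mcons2).
rewrite -(mean_prod gauss gauss bJ).
rewrite (@mean_swap _ _ _ _ _ (gauss \x gauss)%E (gpow n)
  (fun z t => J3 z.1 z.2 t) bJ3).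
rewrite [leRHS](@mean_swap _ _ _ _ _ gauss (gpow n) D bD).
apply: le_mean => [||t].
- apply: (@bmfun_mean _ _ _ _ _ (gpow n)
  (gauss \x gauss)%E (fun t z => J3 z.1 z.2 t)).
  exact: (bmfun_comp bJ3 (@measurable_swap _ _ _ _)).
- apply: (@bmfun_mean _ _ _ _ _ (gpow n) gauss (fun t x => D x t)).
  exact: (bmfun_comp bD (@measurable_swap _ _ _ _)).
rewrite (@mean_prod _ _ _ _ _ gauss gauss (fun x y => J3 x y t) (bJ3xy t)).
exact: (@pair_density_diagonal_le (K ord0) (L ord0) (r ord0) (At t) (Bt t)
  (K0 _) (L0 _) (r0 _) (rKL _) (@upset_head _ A t iA) (@upset_head _ B t iB)).
Qed.

End increasing_sets.

(** * Switching on one coordinate *)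

Section resampling.
Context {R : realType}.
Local Notation gauss := (gauss R).
Local Notation gpow := (gauss_power R).
Local Notation T := (measurableTypeR R).
Implicit Types n : nat.

Lemma measurable_update n (i : 'I_n) :
  measurable_fun setT (fun z : n.-tuple T * T => update i z.1 z.2).
Proof.
apply/measurable_fun_tnthP => j.
rewrite (_ : _ \o _ = fun z : n.-tuple T * T => if j == i then z.2 else tnth
  z.1 j).
  case: (j == i); first exact: measurable_snd.
  exact: (measurableT_comp (measurable_tnth j) measurable_fst).
by apply/funext => z /=; rewrite tnth_update.
Qed.

Lemma bmfun_update n (i : 'I_n) (f : n.-tuple T -> R) : bmfun f ->
  bmfun (fun z : n.-tuple T * T => f (update i z.1 z.2)).
Proof. by move=> bf; exact: (bmfun_comp bf (measurable_update i)). Qed.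

(** The product measure is invariant under resampling one coordinate.  This
isolates the coordinate [i] without reindexing the others. *)
Lemma mean_update n (i : 'I_n) (f : n.-tuple T -> R) : bmfun f ->
  \int[gpow n]_X f X = \int[gpow n]_X \int[gauss]_u f (update i X u).
Proof.
elim: n i f => [[]//|n IH] i f bf.
have bfu := @bmfun_mean _ _ _ _ _ (gpow n.+1) gauss (fun X u => f (update i X
  u))
  (bmfun_update i bf).
rewrite (mean_power_cons bf) (mean_power_cons bfu).
have bfc : bmfun (fun z : T * n.-tuple T => f (cons_pair (z.1, z.2))).
  apply: (bmfun_comp bf (g := fun z : T * n.-tuple T => cons_pair (z.1, z.2))).
  by apply: measurable_cons; [exact: measurable_fst|exact: measurable_snd].
case: (unliftP ord0 i) => [j|] -> {i bfu}.
  apply: eq_Rintegral => x _.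
  rewrite (IH j (fun t => f (cons_pair (x, t))));
    last exact: (@bmfun_section1 _ _ _ _ _ (fun x t => f (cons_pair (x, t)))
    bfc x).
  by apply: eq_Rintegral => t _; apply: eq_Rintegral => u _;
    rewrite update_consS.
transitivity (\int[gauss]_x \int[gpow n]_t \int[gauss]_u f (cons_pair (u : T,
  t))).
  rewrite [RHS](mean_cst gauss (\int[gpow n]_t \int[gauss]_u f (cons_pair (u :
    T, t)))).
  exact: (@mean_swap _ _ _ _ _ gauss (gpow n)
    (fun x t => f (cons_pair (x, t))) bfc).
apply: eq_Rintegral => x _; apply: eq_Rintegral => t _;
  apply: eq_Rintegral => u _.
by rewrite update_cons0.
Qed.

Definition switch_off n (r : 'I_n -> R) (i : 'I_n) : 'I_n -> R :=
  fun j => if j == i then 0 else r j.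

Lemma coupling_density_switch n (K L r : 'I_n -> R) i X Y :
  coupling_density K L r X Y = coupling_density K L (switch_off r i) X Y +
    r i * (trunc (K i) (tnth X i) * trunc (L i)
      (tnth Y i) * coupling_density K L (switch_off r i) X Y).
Proof.
rewrite /coupling_density (bigD1 i)//= [in RHS](bigD1 i)//=.
have -> : \prod_(j < n | j != i) pair_density (K j) (L j) (r j) (tnth X j)
  (tnth Y j) =
  \prod_(j < n | j != i) pair_density (K j) (L j) (switch_off r i j)
    (tnth X j) (tnth Y j).
  by apply: eq_bigr => j /negbTE ji; rewrite /switch_off ji.
set P := \prod_(_ < n | _) _.
by rewrite /switch_off eqxx /pair_density; ring.
Qed.

Lemma coupling_density_updatel n (K L r : 'I_n -> R) i X Y u :
  coupling_density K L (switch_off r i)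
    (update i X u) Y = coupling_density K L (switch_off r i) X Y.
Proof.
apply: eq_bigr => j _; rewrite tnth_update /switch_off.
by case: eqVneq => // _; rewrite /pair_density !mul0r.
Qed.

Lemma coupling_density_updater n (K L r : 'I_n -> R) i X Y u :
  coupling_density K L (switch_off r i) X (update i Y u) = coupling_density K L
    (switch_off r i) X Y.
Proof.
apply: eq_bigr => j _; rewrite tnth_update /switch_off.
by case: eqVneq => // _; rewrite /pair_density !mul0r.
Qed.

Definition coupled_mean n (K L r : 'I_n -> R) (F G : n.-tuple T -> R) : R :=
  \int[gpow n]_X \int[gpow n]_Y (F X * G Y * coupling_density K L r X Y).

Definition fiber_mean n (A : set (n.-tuple T)) (K : R) i X : R :=
  tail_mean K (fiber A i X).

Lemma bmfun_fiber n (A : set (n.-tuple T)) K i : measurable A -> 0 <= K ->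
  bmfun (fun z : n.-tuple T * T => \1_(fiber A i z.1) z.2 * trunc K z.2).
Proof.
move=> mA K0; apply: bmfunM; first exact: (bmfun_update i (bmfun_indic mA)).
exact: (bmfun_comp (bmfun_trunc K0) measurable_snd).
Qed.

Lemma bmfun_fiber_mean n (A : set (n.-tuple T)) K i : measurable A -> 0 <= K ->
  bmfun (fiber_mean A K i).
Proof.
move=> mA K0.
exact: (@bmfun_mean _ _ _ _ _ (gpow n) gauss
  (fun X u => \1_(fiber A i X) u * trunc K u) (bmfun_fiber i mA K0)).
Qed.

Lemma bmfun_tnth_trunc n K (i : 'I_n) : 0 <= K ->
  bmfun (fun X : n.-tuple T => trunc K (tnth X i)).
Proof. by move=> K0; exact: (bmfun_comp (bmfun_trunc K0)
  (measurable_tnth i)). Qed.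

Lemma mean_fiber n (A : set (n.-tuple T)) K i (g : n.-tuple T -> R) :
  measurable A -> 0 <= K -> bmfun g -> (forall X u, g (update i X u) = g X) ->
  \int[gpow n]_X (\1_A X * trunc K (tnth X i) * g X) =
  \int[gpow n]_X (fiber_mean A K i X * g X).
Proof.
move=> mA K0 bg gu.
rewrite (mean_update i); last first.
  apply: bmfunM => //; apply: bmfunM; [exact: bmfun_indic
    |exact: bmfun_tnth_trunc].
apply: eq_Rintegral => X _; rewrite -meanZr; last first.
  exact: (@bmfun_section1 _ _ _ _ _ (fun X u => \1_(fiber A i X) u * trunc K u)
    (bmfun_fiber i mA K0) X).
by apply: eq_Rintegral => u _; rewrite gu tnth_update eqxx.
Qed.

(** The coupling density is affine in [r i], and its slope is a product of a
function of [tnth X i], a function of [tnth Y i] and a density free of these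
coordinates; resampling them integrates over the fibers. *)
Lemma coupled_mean_switch n (K L r : 'I_n -> R) i (A B : set (n.-tuple T)) :
  (forall j, 0 <= K j) -> (forall j, 0 <= L j) -> measurable A ->
    measurable B ->
  coupled_mean K L r \1_A \1_B = coupled_mean K L (switch_off r i) \1_A \1_B +
    r i * coupled_mean K L (switch_off r i) (fiber_mean A (K i) i)
      (fiber_mean B (L i) i).
Proof.
move=> K0 L0 mA mB.
have bA := bmfun_indic (R := R) mA; have bB := bmfun_indic (R := R) mB.
have bk := bmfun_coupling_density (switch_off r i) K0 L0.
pose k := coupling_density K L (switch_off r i).
pose f X : R := \1_A X * trunc (K i) (tnth X i).
pose g Y : R := \1_B Y * trunc (L i) (tnth Y i).
have bf : bmfun f by apply: bmfunM => //; exact: bmfun_tnth_trunc.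
have bg : bmfun g by apply: bmfunM => //; exact: bmfun_tnth_trunc.
have bprod (F G : n.-tuple T -> R) : bmfun F -> bmfun G ->
    bmfun (fun z : n.-tuple T * n.-tuple T => F z.1 * G z.2 * k z.1 z.2).
  move=> bF bG; apply: bmfunM => //.
  by apply: bmfunM; [exact: (bmfun_comp bF measurable_fst)|
                     exact: (bmfun_comp bG measurable_snd)].
have bsec (F G : n.-tuple T -> R) X : bmfun F -> bmfun G ->
    bmfun (fun Y => F X * G Y * k X Y).
  move=> bF bG; exact: (@bmfun_section1 _ _ _ _ _ (fun X Y => F X * G Y * k X
    Y) (bprod _ _ bF bG) X).
have bmean (F G : n.-tuple T -> R) : bmfun F -> bmfun G ->
    bmfun (fun X => \int[gpow n]_Y (F X * G Y * k X Y)).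
  move=> bF bG.
  exact: (@bmfun_mean _ _ _ _ _ (gpow n) (gpow n)
    (fun X Y => F X * G Y * k X Y) (bprod _ _ bF bG)).
have bc c (F : n.-tuple T -> R) : bmfun F -> bmfun (fun x => c * F x).
  by move=> bF; apply: bmfunM => //; exact: bmfun_cst.
transitivity (coupled_mean K L (switch_off r i) \1_A \1_B +
    r i * \int[gpow n]_X \int[gpow n]_Y (f X * g Y * k X Y)).
  rewrite -[in RHS]meanZl; last exact: bmean.
  rewrite -meanD; [|exact: bmean|by apply: bc; exact: bmean].
  apply: eq_Rintegral => X _; rewrite -meanZl; last exact: bsec.
  rewrite -meanD; [|exact: bsec|by apply: bc; exact: bsec].
  by apply: eq_Rintegral => Y _; rewrite (coupling_density_switch _ _ _ i) /f
    /g /k; ring.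
congr (_ + _ * _).
pose h X := \int[gpow n]_Y (g Y * k X Y).
have bgk : bmfun (fun z : n.-tuple T * n.-tuple T => g z.2 * k z.1 z.2).
  by apply: bmfunM => //; exact: (bmfun_comp bg measurable_snd).
have bh : bmfun h.
  exact: (@bmfun_mean _ _ _ _ _ (gpow n) (gpow n) (fun X Y => g Y * k X Y) bgk).
have bgkX X : bmfun (fun Y => g Y * k X Y).
  exact: (@bmfun_section1 _ _ _ _ _ (fun X Y => g Y * k X Y) bgk X).
transitivity (\int[gpow n]_X (f X * h X)).
  apply: eq_Rintegral => X _; rewrite -meanZl//.
  by apply: eq_Rintegral => Y _; rewrite mulrA.
rewrite /f mean_fiber//; last first.
  by move=> X u; apply: eq_Rintegral => Y _;
    rewrite /k coupling_density_updatel.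
apply: eq_Rintegral => X _.
have bkX : bmfun (k X).
  exact: (@bmfun_section1 _ _ _ _ _ k bk X).
rewrite /h /g mean_fiber//; last by move=> Y u; exact: coupling_density_updater.
rewrite -meanZl; last by apply: bmfunM => //; exact: bmfun_fiber_mean.
by apply: eq_Rintegral => Y _; rewrite mulrA.
Qed.

End resampling.

(** * Influences *)

Section influences.
Context {R : realType}.
Local Notation gauss := (gauss R).
Local Notation gpow := (gauss_power R).
Local Notation T := (measurableTypeR R).
Local Notation phi := (@normal_pdf R 0 1).
Implicit Types n : nat.

(** The integral of the positive part of [f] is a supremum over simple functions,
hence monotone even when [f] is not measurable.  This form applies to the
Minkowski content of the fibers without discussing its measurability. *)
Lemma integral_le_mean d (S : measurableType d) (P : probability S R)
    (f : S -> \bar R) (g : S -> R) :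
  bmfun g -> (forall x, 0 <= g x) -> (forall x, (f x <= (g x)%:E)%E) ->
  (\int[P]_x f x <= (\int[P]_x g x)%:E)%E.
Proof.
move=> bg g0 fg; rewrite integralE.
apply: (@le_trans _ _ (\int[P]_x f^\+ x)%E).
  by rewrite -[leRHS]adde0 leeD2l// oppe_le0 integral_ge0.
have f0 x : (0 <= f^\+ x)%E by exact: funepos_ge0.
rewrite EFin_mean// !ge0_integralTE//.
apply: le_ereal_sup => _ [h hf <-]; exists h => // x.
by apply: le_trans (hf x) _; rewrite funeposE ge_max fg /= lee_fin g0.
Qed.

Lemma fiber_mean_ge0 n (A : set (n.-tuple T)) K i X : increasing A -> 0 <= K ->
  0 <= fiber_mean A K i X.
Proof. by move=> iA K0; apply: tail_mean_ge0 => //; exact: upset_fiber. Qed.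

Lemma fiber_mean_le1 n (A : set (n.-tuple T)) K i X : increasing A -> 0 <= K ->
  fiber_mean A K i X <= 1.
Proof. by move=> iA K0; apply: tail_mean_le1 => //; exact: upset_fiber. Qed.

Lemma influence_le n (A : set (n.-tuple T)) i K : measurable A ->
  increasing A ->
  0 <= K ->
  fine (influence A i) <= \int[gpow n]_X fiber_mean A K i X + phi K.
Proof.
move=> mA iA K0; have bH := bmfun_fiber_mean i mA K0.
have H0 X := @fiber_mean_ge0 n A K i X iA K0.
rewrite -[X in _ + X](mean_cst (gpow n)) -meanD//; last exact: bmfun_cst.
set m := \int[_]_x _.
have : (influence A i <= m%:E)%E.
  apply: integral_le_mean.
  - by apply: bmfunD => //; exact: bmfun_cst.
  - by move=> X; rewrite addr_ge0// gauss_pdf_ge0.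
  - by move=> X; apply: lower_minkowski_le => //; exact: upset_fiber.
have m0 : 0 <= m by apply: mean_ge0 => X; rewrite addr_ge0// gauss_pdf_ge0.
by case: (influence A i) => [x| |]//=; rewrite lee_fin.
Qed.

Lemma influence_le_half n (A : set (n.-tuple T)) i : measurable A ->
  increasing A -> fine (influence A i) <= 2^-1.
Proof.
move=> mA iA; have := @influence_le n A i 0 mA iA (lexx 0).
(* Truncating at level 0 leaves nothing. *)
have -> : \int[gpow n]_X fiber_mean A 0 i X = 0.
  rewrite -[RHS](mean_cst (gpow n)); apply: eq_Rintegral => X _.
  rewrite -[RHS](mean_cst gauss); apply: eq_Rintegral => u _.
  by rewrite /trunc normr_le0; case: eqVneq => [->|_]; rewrite mulr0.
by rewrite add0r => /le_trans; apply; exact: gauss_pdf_le.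
Qed.

(** The truncation level [K] at which [phi K] is [phi 0 * a / expR 1], so that
truncating loses at most half of an influence equal to [a]. *)
Definition level (a : R) : R := Num.sqrt (2 * ln (expR 1 / a)).

Lemma level_ge0 a : 0 <= level a. Proof. exact: sqrtr_ge0. Qed.

Lemma ln_eV (a : R) : 0 < a -> ln (expR 1 / a) = 1 - ln a.
Proof. by move=> a0; rewrite ln_div ?posrE ?expR_gt0// expRK. Qed.

Lemma ln_eV_ge1 (a : R) : 0 < a -> a <= 2^-1 -> 1 <= ln (expR 1 / a).
Proof.
move=> a0 a2; rewrite ln_eV// lerBrDr gerDl.
by apply: ln_le0; lra.
Qed.

Lemma level_sqr a : 0 < a -> a <= 2^-1 -> level a ^+ 2 = 2 * ln (expR 1 / a).
Proof.
move=> a0 a2; rewrite sqr_sqrtr// mulr_ge0//.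
by apply: le_trans (ln_eV_ge1 a0 a2).
Qed.

Lemma gauss_pdf_level a : 0 < a -> a <= 2^-1 -> phi (level a) <= a / 2.
Proof.
move=> a0 a2; rewrite gauss_pdfE level_sqr// mulNr mulrAC divff// mul1r.
rewrite expRN lnK ?posrE ?divr_gt0 ?expR_gt0// invf_div.
have e1 : a / expR 1 <= a.
  rewrite ler_pdivrMr ?expR_gt0// ler_peMr ?ltW//.
  by have := expR_ge1Dx (1 : R); lra.
have ae0 : 0 <= a / expR 1 by rewrite divr_ge0 ?expR_ge0// ltW.
apply: le_trans (ler_wpM2r ae0 (@normal_peak1_le R)) _.
by rewrite mulrC ler_pM2r.
Qed.

(** On values in [0,1] the power only increases [H].  The remaining exponent
exceeds 1 by the inverse of [2 * ln (expR 1 / a) - 1], so that raising [a / 2] to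
it costs at most a factor [expR 1]. *)
Lemma powR_mean_ge n (H : n.-tuple T -> R) a : 0 < a -> a <= 2^-1 ->
  bmfun H -> (forall X, 0 <= H X) -> (forall X, H X <= 1) ->
  a / 2 <= \int[gpow n]_X H X ->
  a / (2 * expR 1) <=
  (\int[gpow n]_X (H X `^ (1 - (level a ^+ 2)^-1))) `^ (1 - (level a ^+
    2)^-1)^-1.
Proof.
move=> a0 a2 bH H0 H1 aH.
have l1 := ln_eV_ge1 a0 a2.
rewrite level_sqr//; set l := ln (expR 1 / a) in l1 *.
have l2 : (2 * l)^-1 <= 2^-1 by rewrite lef_pV2 ?posrE; lra.
have l20 : 0 < (2 * l)^-1 by rewrite invr_gt0; lra.
set p := 1 - (2 * l)^-1.
have p0 : 0 < p by rewrite /p; lra.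
have p1 : p <= 1 by rewrite /p; lra.
have h1 : \int[gpow n]_X H X <= \int[gpow n]_X (H X `^ p).
  apply: le_mean => //; first by apply: bmfun_powR => //; exact: ltW.
  move=> X; have := H0 X; rewrite le_eqVlt => /predU1P[<-|HX].
    by rewrite powR0// gt_eqF.
  by rewrite ger1_powR// HX H1.
have a20 : 0 < a / 2 by lra.
apply: (@le_trans _ _ ((a / 2) `^ p^-1)); last first.
  have h2 := le_trans aH h1.
  rewrite ge0_ler_powR// ?nnegrE ?invr_ge0 ?(ltW p0) ?(ltW a20)//.
  by rewrite (le_trans _ h2)// ltW.
have -> : a / (2 * expR 1) = expR (ln (a / 2) - 1).
  by rewrite expRB lnK ?posrE// invfM mulrA.
rewrite /powR gt_eqF// ler_expR.
rewrite ln_div ?posrE//.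
have la : ln a = 1 - l by rewrite /l ln_eV//; lra.
have ln2 : 0 <= ln (2 : R) <= 1.
  apply/andP; split; first by apply: ln_ge0; lra.
  by have := @le_ln1Dx R 1; rewrite (_ : 1 + 1 = 2)//; apply; lra.
have -> : p^-1 = 1 + (2 * l - 1)^-1.
  rewrite /p; field; do ?(apply/andP; split); rewrite gt_eqF//; lra.
rewrite la mulrDl mul1r.
have k0 : 0 < 2 * l - 1 by lra.
rewrite lerD2l [leRHS]mulrC ler_pdivlMr//; lra.
Qed.

End influences.

(** * The correlation inequality *)

Section correlation.
Context {R : realType}.
Local Notation gpow := (gauss_power R).
Local Notation T := (measurableTypeR R).
Local Notation M := (@hc_const R).
Implicit Types n : nat.

Let M0 : 0 < M. Proof. exact: lt_le_trans ltr01 (@hc_const_ge1 R). Qed.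

(** The largest parameter admissible for levels [K] and [L]; it is 0 when one of
them is 0. *)
Definition coupling_rate (K L : R) : R := (M * (K * L))^-1.

Lemma coupling_rate_ge0 K L : 0 <= K -> 0 <= L -> 0 <= coupling_rate K L.
Proof. by move=> K0 L0; rewrite invr_ge0 !mulr_ge0// ltW. Qed.

Lemma coupling_rate_le1 K L : M * (coupling_rate K L * K * L) <= 1.
Proof.
have [->|K0] := eqVneq K 0; first by rewrite mulr0 mul0r mulr0.
have [->|L0] := eqVneq L 0; first by rewrite mulr0 mulr0.
rewrite (_ : M * _ = coupling_rate K L * (M * (K * L))); last by ring.
by rewrite mulVf// !mulf_neq0// gt_eqF.
Qed.

Lemma coupled_mean0 n (K L : 'I_n -> R) (A B : set (n.-tuple T)) :
  measurable A -> measurable B ->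
  coupled_mean K L (fun=> 0) \1_A \1_B =
  fine (gpow n A) * fine (gpow n B).
Proof.
move=> mA mB; rewrite -!mean_indic// -meanZr; last exact: bmfun_indic.
apply: eq_Rintegral => X _; rewrite -meanZl; last exact: bmfun_indic.
apply: eq_Rintegral => Y _; rewrite /coupling_density big1 ?mulr1// => j _.
by rewrite /pair_density !mul0r addr0.
Qed.

Lemma coupled_mean_le n (K L r : 'I_n -> R) (A B : set (n.-tuple T)) :
  (forall j, 0 <= K j) -> (forall j, 0 <= L j) -> (forall j, 0 <= r j) ->
  (forall j, r j * K j * L j <= 1) ->
  measurable A -> measurable B -> increasing A -> increasing B ->
  coupled_mean K L r \1_A \1_B <= fine (gpow n (A `&` B)).
Proof.
move=> K0 L0 r0 rKL mA mB iA iB.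
apply: le_trans (mean_coupling_density_le_diagonal K0 L0 r0 rKL mA mB iA iB) _.
rewrite -mean_indic; last exact: measurableI.
rewrite le_eqVlt; apply/orP; left; apply/eqP; apply: eq_Rintegral => X _.
by rewrite !indicE in_setI -natrM mulnb.
Qed.

Definition gain (x y : R) : R :=
  if (0 < x) && (0 < y) then
    coupling_rate (level x) (level y) * (x / (2 * expR 1) * (y / (2 * expR 1)))
  else 0.

Definition restrict n (r : 'I_n -> R) (S : {set 'I_n}) : 'I_n -> R :=
  fun j => if j \in S then r j else 0.

Lemma switch_off_restrict n (r : 'I_n -> R) S i :
  switch_off (restrict r S) i = restrict r (S :\ i).
Proof. by apply/funext => j; rewrite /switch_off /restrict in_setD1;
  case: eqVneq. Qed.

Lemma mean_fiber_ge n (A : set (n.-tuple T)) i : measurable A -> increasing A ->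
  let a := fine (influence A i) in 0 < a ->
  a / 2 <= \int[gpow n]_X fiber_mean A (level a) i X.
Proof.
move=> mA iA a a0.
have a2 : a <= 2^-1 := influence_le_half i mA iA.
have := influence_le i mA iA (level_ge0 a); rewrite -/a.
have := gauss_pdf_level a0 a2; lra.
Qed.

Lemma inv_level_sqr (a : R) : 0 < a -> a <= 2^-1 ->
  0 < (level a ^+ 2)^-1 <= 2^-1.
Proof.
move=> a0 a2; rewrite level_sqr//; have l1 := ln_eV_ge1 a0 a2.
by rewrite invr_gt0 lef_pV2 ?posrE; lra.
Qed.

Section pair_of_sets.
Variables (n : nat) (A B : set (n.-tuple T)).
Hypotheses (mA : measurable A) (mB : measurable B).
Hypotheses (iA : increasing A) (iB : increasing B).
Local Notation a := (fun i => fine (influence A i)).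
Local Notation b := (fun i => fine (influence B i)).
Local Notation K := (fun i => level (fine (influence A i))).
Local Notation L := (fun i => level (fine (influence B i))).
Local Notation rho :=
  (fun i => coupling_rate (level (fine (influence A i)))
    (level (fine (influence B i)))).

Let K0 j : 0 <= K j. Proof. exact: level_ge0. Qed.
Let L0 j : 0 <= L j. Proof. exact: level_ge0. Qed.

Let rho0 j : 0 <= rho j. Proof. exact: coupling_rate_ge0 (K0 j) (L0 j). Qed.

Let restrict_ge0 S j : 0 <= restrict rho S j.
Proof. by rewrite /restrict; case: ifP => _; [exact: rho0|exact: lexx]. Qed.

Let restrict_le1 S j : M * (restrict rho S j * K j * L j) <= 1.
Proof.
rewrite /restrict; case: ifP => _; first exact: coupling_rate_le1.
by rewrite !mul0r mulr0 ler01.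
Qed.

Let restrict_le1' S j : restrict rho S j * K j * L j <= 1.
Proof.
apply: le_trans (restrict_le1 S j); rewrite ler_peMl//.
  exact: mulr_ge0 (mulr_ge0 (restrict_ge0 S j) (K0 j)) (L0 j).
exact: hc_const_ge1.
Qed.

(** Among the coordinates in [S], [i] has the largest coefficient; hence the
exponents fitted to the influences of [i] are admissible for all the others. *)
Lemma coupled_mean_gain (S : {set 'I_n}) i : i \in S ->
  (forall j, j \in S -> rho j <= rho i) ->
  coupled_mean K L (restrict rho (S :\ i)) \1_A \1_B + gain (a i) (b i) <=
  coupled_mean K L (restrict rho S) \1_A \1_B.
Proof.
move=> iS maxi.
rewrite [leRHS](coupled_mean_switch (restrict rho S) i K0 L0 mA mB).
rewrite switch_off_restrict lerD2l {1}/restrict iS.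
rewrite /gain; case: ifPn => [/andP[a0 b0]|_]; last first.
  apply: mulr_ge0 (rho0 i) _.
  apply: mean_ge0 => X; apply: mean_ge0 => Y.
  apply: mulr_ge0; last exact: coupling_density_ge0 K0 L0 (restrict_ge0 _)
    (restrict_le1' _).
  exact: mulr_ge0 (fiber_mean_ge0 i X iA (K0 i)) (fiber_mean_ge0 i Y iB (L0 i)).
have a2 : a i <= 2^-1 := influence_le_half i mA iA.
have b2 : b i <= 2^-1 := influence_le_half i mB iB.
apply: (ler_wpM2l (rho0 i)).
have rst j : (M * restrict rho (S :\ i) j) ^+ 2 <=
    (K i ^+ 2)^-1 * (L i ^+ 2)^-1.
  rewrite -invfM -exprMn -exprVn; apply: lerXn2r; rewrite ?nnegrE.
  - exact: mulr_ge0 (ltW M0) (restrict_ge0 _ j).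
  - by rewrite invr_ge0; exact: mulr_ge0 (K0 i) (L0 i).
  apply: (@le_trans _ _ (M * rho i)).
    rewrite ler_pM2l; last exact: M0.
    rewrite /restrict in_setD1; case: ifP => [/andP[_ jS]|_]; last exact: rho0.
    exact: maxi.
  by rewrite /coupling_rate invfM mulrA divff ?mul1r// gt_eqF//; exact: M0.
have bHA := bmfun_fiber_mean i mA (K0 i).
have bHB := bmfun_fiber_mean i mB (L0 i).
apply: le_trans (reverse_hypercontractive bHA bHB
  (fun X => fiber_mean_ge0 i X iA (K0 i))
    (fun X => fiber_mean_ge0 i X iB (L0 i))
  (inv_level_sqr a0 a2) (inv_level_sqr b0 b2)
  K0 L0 (restrict_ge0 _) (restrict_le1 _) rst).
have e0 : 0 <= 2 * expR (1 : R) by rewrite mulr_ge0// expR_ge0.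
apply: ler_pM (divr_ge0 (ltW a0) e0) (divr_ge0 (ltW b0) e0) _ _.
- exact: powR_mean_ge a0 a2 bHA (fun X => fiber_mean_ge0 i X iA (K0 i))
    (fun X => fiber_mean_le1 i X iA (K0 i)) (mean_fiber_ge mA iA a0).
- exact: powR_mean_ge b0 b2 bHB (fun X => fiber_mean_ge0 i X iB (L0 i))
    (fun X => fiber_mean_le1 i X iB (L0 i)) (mean_fiber_ge mB iB b0).
Qed.

(** Induction on the set of coordinates that are on, switching off one with the
largest coefficient. *)
Lemma coupled_mean_sum_gain (S : {set 'I_n}) :
  fine (gpow n A) * fine (gpow n B) + \sum_(i in S) gain (a i) (b i) <=
  coupled_mean K L (restrict rho S) \1_A \1_B.
Proof.
have [m] := ubnP #|S|; elim: m S => // m IH S Sm.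
have [->|/set0Pn[i0 i0S]] := eqVneq S finset.set0.
  rewrite big_set0 addr0 (_ : restrict _ _ = fun=> 0) ?coupled_mean0//.
  by apply/funext => j; rewrite /restrict inE.
case: (@Order.TotalTheory.arg_maxP _ _ _ i0 (mem S) rho i0S) => i Si maxi.
have iS : i \in S by exact: Si.
rewrite (big_setD1 i)//= addrCA.
apply: le_trans (coupled_mean_gain iS maxi).
rewrite addrC lerD2r; apply: IH.
by rewrite (cardsD1 i S) iS in Sm.
Qed.

Lemma sum_gain_le_covariance : \sum_(i < n) gain (a i) (b i) <=
  fine (gpow n (A `&` B)) - fine (gpow n A) * fine (gpow n B).
Proof.
rewrite lerBrDl.
have := coupled_mean_sum_gain [set: 'I_n].
rewrite (eq_bigl xpredT) => [|i]; last by rewrite inE.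
move=> /le_trans; apply.
exact: coupled_mean_le K0 L0 (restrict_ge0 _) (restrict_le1' _) mA mB iA iB.
Qed.

End pair_of_sets.

(** The two levels contribute a factor 2 to the constant, and the two means a
factor [(2 * expR 1) ^+ 2].  When an influence [x] is not positive,
[ln (expR 1 / x)] is 0 and both sides vanish. *)
Lemma gainE (a b : R) : a <= 2^-1 -> b <= 2^-1 ->
  gain a b = (8 * M * expR 1 ^+ 2)^-1 *
    (a * b / Num.sqrt (ln (expR 1 / a) * ln (expR 1 / b))).
Proof.
move=> a2 b2; rewrite /gain; case: ifPn => [/andP[a0 b0]|].
  have la := ln_eV_ge1 a0 a2; have lb := ln_eV_ge1 b0 b2.
  have e0 := expR_gt0 (1 : R).
  set x := ln _ in la *; set y := ln _ in lb *.
  rewrite /coupling_rate /level -/x -/y !sqrtrM; [|lra..].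
  have -> : Num.sqrt 2 * Num.sqrt x * (Num.sqrt 2 * Num.sqrt y) =
      2 * (Num.sqrt x * Num.sqrt y).
    by rewrite mulrACA -expr2 sqr_sqrtr.
  have x0 : 0 < Num.sqrt x by rewrite sqrtr_gt0; lra.
  have y0 : 0 < Num.sqrt y by rewrite sqrtr_gt0; lra.
  by field; rewrite !gt_eqF.
rewrite negb_and -!leNgt => ab0.
have -> : ln (expR 1 / a) * ln (expR 1 / b) = 0.
  have lnV0 c : c <= 0 -> ln (expR 1 / c) = 0 :> R.
    by move=> c0; rewrite ln0// mulr_ge0_le0 ?expR_ge0// invr_le0.
  by case/orP: ab0 => /lnV0 ->; rewrite ?mul0r ?mulr0.
by rewrite sqrtr0 invr0 !mulr0.
Qed.

End correlation.

Theorem theorem1p7 (R : realType) :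
  exists2 c : R, 0 < c &
    forall (n : nat) (A B : set (n.-tuple (measurableTypeR R))),
      measurable A -> measurable B -> increasing A -> increasing B ->
      c * (\sum_(i < n)
             let a := fine (influence A i) in
             let b := fine (influence B i) in
             a * b / Num.sqrt (ln (expR 1 / a) * ln (expR 1 / b)))
        <= fine (gauss_power R n (A `&` B))
           - fine (gauss_power R n A) * fine (gauss_power R n B).
Proof.
exists (8 * hc_const * expR 1 ^+ 2)^-1.
  by rewrite invr_gt0 !mulr_gt0 ?exprn_gt0 ?expR_gt0// (lt_le_trans ltr01)//
    hc_const_ge1.
move=> n A B mA mB iA iB; apply: le_trans (sum_gain_le_covariance mA mB iA iB).
rewrite mulr_sumr; apply: ler_sum => i _ /=.
by rewrite gainE//; exact: influence_le_half.
Qed.
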